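(* Let $Y_1,Y_2\in\{\widetilde X,\widetilde\Xi\}$. The following elements of $\mathrm{Pol}(Y_1\times Y_2)_q$ are invariants (i.e. $\xi k=\varepsilon(\xi)k$ for all $\xi\in U_q\mathfrak{sl}_2$): $$k_{11}=t_{11}\tau_{22}-qt_{12}\tau_{21};\qquad k_{12}=-q^{-1}t_{11}\tau_{12}+t_{12}\tau_{11};$$ $$k_{21}=t_{21}\tau_{22}-qt_{22}\tau_{21};\qquad k_{22}=-q^{-1}t_{21}\tau_{12}+t_{22}\tau_{11}.$$
   Context: Fix $0<q<1$ and $h>0$ with $q=e^{-h/2}$. $U_q\mathfrak{sl}_2$ is the Hopf algebra generated by $H,X^\pm$ (and $e^{\pm hH/4}$) with $[H,X^\pm]=\pm2X^\pm$, $[X^+,X^-]=\frac{e^{hH/2}-e^{-hH/2}}{e^{h/2}-e^{-h/2}}$, $\Delta(H)=H\otimes1+1\otimes H$, $\Delta(X^\pm)=X^\pm\otimes e^{hH/4}+e^{-hH/4}\otimes X^\pm$, $\varepsilon(H)=\varepsilon(X^\pm)=0$, $S(H)=-H$, $S(X^\pm)=-q^{\mp1}X^\pm$; in all modules considered $H$ acts diagonally with integer eigenvalues. For $Y\in\{\widetilde X,\widetilde\Xi\}$ put $\delta_{\widetilde X}=1$, $\delta_{\widetilde\Xi}=0$. $\mathrm{Pol}(Y)_q$ is the unital $U_q\mathfrak{sl}_2$-module algebra with generators $t_{ij}$, $i,j=1,2$, relations $t_{11}t_{12}=qt_{12}t_{11}$, $t_{21}t_{22}=qt_{22}t_{21}$,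 $t_{11}t_{21}=qt_{21}t_{11}$, $t_{12}t_{22}=qt_{22}t_{12}$, $t_{12}t_{21}=t_{21}t_{12}$, $t_{11}t_{22}-t_{22}t_{11}=(q-q^{-1})t_{12}t_{21}$, $t_{11}t_{22}-qt_{12}t_{21}=\delta_Y$, and action $X^+t_{i1}=0$, $X^+t_{i2}=t_{i1}$, $X^-t_{i1}=t_{i2}$, $X^-t_{i2}=0$, $Ht_{i1}=t_{i1}$, $Ht_{i2}=-t_{i2}$ ($i=1,2$). $\mathrm{Pol}(Y_1\times Y_2)_q=\mathrm{Pol}(Y_1)_q^{\mathrm{op}}\otimes\mathrm{Pol}(Y_2)_q$, where op denotes the opposite multiplication; as a $U_q\mathfrak{sl}_2$-module it is the tensor product $\mathrm{Pol}(Y_1)_q\otimes\mathrm{Pol}(Y_2)_q$ (action via $\Delta$). In it $t_{ij}$ denotes $t_{ij}\otimes1$ and $\tau_{ij}$ denotes $1\otimes t_{ij}$. *)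

(* Defs.v *)
From HB Require Import structures.
From mathcomp Require Import all_boot all_order all_algebra.
From mathcomp Require Import complex ring lra.
From mathcomp Require Import boolp reals sequences exp.

Set Implicit Arguments.
Unset Strict Implicit.
Unset Printing Implicit Defensive.

Import Order.TTheory GRing.Theory Num.Theory.

Local Open Scope ring_scope.
Local Open Scope quotient_scope.

Section LinearFunctions.
Variables (K : pzRingType) (V W : lmodType K) (f : V -> W).
Hypothesis f_linear : linear f.

Lemma linear_fD u v : f (u + v) = f u + f v.
Proof. by have := f_linear 1 u v; rewrite !scale1r. Qed.

Lemma linear_f0 : f 0 = 0.
Proof.
have := f_linear (-1) 0 0; rewrite scaler0 addr0 => ->.
by rewrite scaleN1r addNr.
Qed.

Lemma linear_fZ c v : f (c *: v) = c *: f v.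
Proof. by have := f_linear c v 0; rewrite !addr0 linear_f0 addr0. Qed.

Lemma linear_fN v : f (- v) = - f v.
Proof. by rewrite -scaleN1r linear_fZ scaleN1r. Qed.

End LinearFunctions.

HB.instance Definition _ (K : pzRingType) (V : lmodType K) :=
  GRing.Lmodule.copy V^c V.

HB.instance Definition _ (K : pzRingType) (A : algType K) :=
  GRing.Lmodule_isLalgebra.Build K A^c
    (fun c (x y : A) => scalerAr c y x).

HB.instance Definition _ (K : pzRingType) (A : algType K) :=
  GRing.Lalgebra_isAlgebra.Build K A^c
    (fun c (x y : A) => scalerAl c y x).

Inductive word (K G : Type) : Type :=
| Gen of G
| Scal of K
| Add of word K G & word K G
| Mul of word K G & word K G.

Arguments Gen {K G}.
Arguments Scal {K G}.

Declare Scope word_scope.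
Delimit Scope word_scope with W.
Bind Scope word_scope with word.
Notation "x + y" := (Add x y) : word_scope.
Notation "x * y" := (Mul x y) : word_scope.
Notation "c *: x" := (Mul (Scal c%R) x) : word_scope.
Notation "x - y" := (Add x (Mul (Scal (-1)%R) y)) : word_scope.

HB.instance Definition _ (K G : Type) := gen_eqMixin (word K G).
HB.instance Definition _ (K G : Type) := gen_choiceMixin (word K G).

Section PresentedAlgebra.
Variables (K : comNzRingType) (G : Type).
Variable rels : word K G -> word K G -> Prop.

(* The least congruence that contains [rels] and whose quotient is a
   unital associative K-algebra. *)
Inductive wcong : word K G -> word K G -> Prop :=
| WRel x y of rels x y : wcong x y
| WRefl x : wcong x x
| WSym x y of wcong x y : wcong y x
| WTrans x y z of wcong x y & wcong y z : wcong x z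
| WAdd x x' y y' of wcong x x' & wcong y y' : wcong (x + y)%W (x' + y')%W
| WMul x x' y y' of wcong x x' & wcong y y' : wcong (x * y)%W (x' * y')%W
| WAddA x y z : wcong (x + (y + z))%W (x + y + z)%W
| WAddC x y : wcong (x + y)%W (y + x)%W
| WAdd0 x : wcong (Scal 0 + x)%W x
| WMulA x y z : wcong (x * (y * z))%W (x * y * z)%W
| WMul1 x : wcong (Scal 1 * x)%W x
| WMulDl x y z : wcong ((x + y) * z)%W (x * z + y * z)%W
| WMulDr x y z : wcong (x * (y + z))%W (x * y + x * z)%W
| WMul0 x : wcong (Scal 0 * x)%W (Scal 0)
| WScalD a b : wcong (Scal (a + b)) (Scal a + Scal b)%W
| WScalM a b : wcong (Scal (a * b)) (Scal a * Scal b)%W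
| WScalC a x : wcong (Scal a * x)%W (x * Scal a)%W.

Definition wequiv : rel (word K G) := fun x y => `[< wcong x y >].

Lemma wequiv_refl : reflexive wequiv.
Proof. by move=> x; apply/asboolP; exact: WRefl. Qed.

Lemma wequiv_sym : symmetric wequiv.
Proof. by move=> x y; apply/asboolP/asboolP; exact: WSym. Qed.

Lemma wequiv_trans : transitive wequiv.
Proof.
by move=> y x z /asboolP xy /asboolP yz; apply/asboolP; exact: WTrans yz.
Qed.

Canonical wequiv_rel := EquivRel wequiv wequiv_refl wequiv_sym wequiv_trans.

Definition palg : Type := {eq_quot wequiv_rel}.
HB.instance Definition _ := Choice.on palg.
HB.instance Definition _ := EqQuotient.on palg.

Definition pclass (w : word K G) : palg := \pi_palg w.

Lemma pclass_eq x y : wcong x y -> pclass x = pclass y.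
Proof. by move=> xy; apply/eqmodP/asboolP. Qed.

Lemma pclassP x y : pclass x = pclass y -> wcong x y.
Proof. by move=> /eqmodP/asboolP. Qed.

Lemma repr_pclass x : wcong (repr (pclass x)) x.
Proof. by apply: pclassP; rewrite /pclass reprK. Qed.

Lemma pclassK (x : palg) : pclass (repr x) = x.
Proof. exact: reprK. Qed.

Definition padd (x y : palg) := pclass (repr x + repr y)%W.
Definition pmul (x y : palg) := pclass (repr x * repr y)%W.
Definition pscale (c : K) (x : palg) := pclass (c *: repr x)%W.
Definition popp (x : palg) := pscale (-1) x.

Lemma paddE x y : padd (pclass x) (pclass y) = pclass (x + y)%W.
Proof. by apply: pclass_eq; apply: WAdd; exact: repr_pclass. Qed.

Lemma pmulE x y : pmul (pclass x) (pclass y) = pclass (x * y)%W.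
Proof. by apply: pclass_eq; apply: WMul; exact: repr_pclass. Qed.

Lemma pscaleE c x : pscale c (pclass x) = pclass (c *: x)%W.
Proof.
by apply: pclass_eq; apply: WMul; [exact: WRefl | exact: repr_pclass].
Qed.

Lemma palgP (P : palg -> Prop) : (forall w, P (pclass w)) -> forall x, P x.
Proof. by move=> Pw x; rewrite -(pclassK x). Qed.

Lemma paddA : associative padd.
Proof.
elim/palgP=> x; elim/palgP=> y; elim/palgP=> z.
by rewrite !paddE; apply: pclass_eq; exact: WAddA.
Qed.

Lemma paddC : commutative padd.
Proof.
elim/palgP=> x; elim/palgP=> y.
by rewrite !paddE; apply: pclass_eq; exact: WAddC.
Qed.

Lemma padd0 : left_id (pclass (Scal 0)) padd.
Proof. by elim/palgP=> x; rewrite !paddE; apply: pclass_eq; exact: WAdd0. Qed.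

Lemma pscale1 : left_id 1 pscale.
Proof. by elim/palgP=> x; rewrite pscaleE; apply: pclass_eq; exact: WMul1. Qed.

Lemma pscaleDl x : {morph pscale^~ x : a b / a + b >-> padd a b}.
Proof.
move=> a b; elim/palgP: x => x.
rewrite !pscaleE !paddE; apply: pclass_eq.
by apply: WTrans (WMulDl _ _ _); apply: WMul (WRefl _); exact: WScalD.
Qed.

Lemma paddN : left_inverse (pclass (Scal 0)) popp padd.
Proof.
move=> x; rewrite /popp -{2}(pscale1 x) -pscaleDl addNr.
by elim/palgP: x => x; rewrite pscaleE; apply: pclass_eq; exact: WMul0.
Qed.

HB.instance Definition _ :=
  GRing.isZmodule.Build palg paddA paddC padd0 paddN.

Lemma pmulA : associative pmul.
Proof.
elim/palgP=> x; elim/palgP=> y; elim/palgP=> z.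
by rewrite !pmulE; apply: pclass_eq; exact: WMulA.
Qed.

Lemma pmul1 : left_id (pclass (Scal 1)) pmul.
Proof. by elim/palgP=> x; rewrite !pmulE; apply: pclass_eq; exact: WMul1. Qed.

Lemma pmulr1 : right_id (pclass (Scal 1)) pmul.
Proof.
elim/palgP=> x; rewrite !pmulE; apply: pclass_eq.
by apply: WTrans (WMul1 _); apply: WSym; exact: WScalC.
Qed.

Lemma pmulDl : left_distributive pmul +%R.
Proof.
elim/palgP=> x; elim/palgP=> y; elim/palgP=> z.
rewrite /GRing.add /= !(paddE, pmulE); apply: pclass_eq; exact: WMulDl.
Qed.

Lemma pmulDr : right_distributive pmul +%R.
Proof.
elim/palgP=> x; elim/palgP=> y; elim/palgP=> z.
rewrite /GRing.add /= !(paddE, pmulE); apply: pclass_eq; exact: WMulDr.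
Qed.

HB.instance Definition _ :=
  GRing.Zmodule_isPzRing.Build palg pmulA pmul1 pmulr1 pmulDl pmulDr.

Lemma pscaleA a b x : pscale a (pscale b x) = pscale (a * b) x.
Proof.
elim/palgP: x => x; rewrite !pscaleE; apply: pclass_eq.
apply: WTrans (WMulA _ _ _) _; apply: WMul (WRefl _).
by apply: WSym; exact: WScalM.
Qed.

Lemma pscaleDr : right_distributive pscale +%R.
Proof.
move=> c; elim/palgP=> x; elim/palgP=> y.
rewrite /GRing.add /= !(paddE, pscaleE); apply: pclass_eq; exact: WMulDr.
Qed.

HB.instance Definition _ :=
  GRing.Zmodule_isLmodule.Build K palg pscaleA pscale1 pscaleDr pscaleDl.

Lemma pscaleAl (c : K) (x y : palg) : c *: (x * y) = (c *: x) * y.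
Proof.
elim/palgP: x => x; elim/palgP: y => y.
rewrite /GRing.scale /GRing.mul /= !(pmulE, pscaleE).
by apply: pclass_eq; exact: WMulA.
Qed.

Lemma pscaleAr (c : K) (x y : palg) : c *: (x * y) = x * (c *: y).
Proof.
elim/palgP: x => x; elim/palgP: y => y.
rewrite /GRing.scale /GRing.mul /= !(pmulE, pscaleE).
apply: pclass_eq; apply: WTrans (WMulA _ _ _) _.
apply: WTrans (WSym (WMulA _ _ _)); apply: WMul (WRefl _); exact: WScalC.
Qed.

Definition pgen (g : G) : palg := pclass (Gen g).

Lemma pclassD x y : pclass (x + y)%W = pclass x + pclass y.
Proof. by rewrite [RHS]paddE. Qed.

Lemma pclassM x y : pclass (x * y)%W = pclass x * pclass y.
Proof. by rewrite [RHS]pmulE. Qed.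

Lemma pclassS c : pclass (Scal c) = c *: (1 : palg).
Proof. by rewrite [RHS]pscaleE [RHS](pclass_eq (WScalC _ _)) -[RHS]pmulE [RHS]pmul1. Qed.

Lemma palg_ind (P : palg -> Prop) :
  (forall g, P (pgen g)) -> P 1 -> (forall c x, P x -> P (c *: x)) ->
  (forall x y, P x -> P y -> P (x + y)) ->
  (forall x y, P x -> P y -> P (x * y)) -> forall x, P x.
Proof.
move=> Pg P1 PZ PD PM; elim/palgP; elim=> [//|c|x Px y Py|x Px y Py].
- by rewrite pclassS; exact: PZ.
- by rewrite pclassD; exact: PD.
- by rewrite pclassM; exact: PM.
Qed.

Section Lift.
Variables (A : pzRingType) (iota : {rmorphism K -> A}) (f : G -> A).

Fixpoint weval (w : word K G) : A :=
  match w with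
  | Gen g => f g
  | Scal c => iota c
  | Add x y => weval x + weval y
  | Mul x y => weval x * weval y
  end.

Definition plift (x : palg) : A := weval (repr x).

Hypothesis iotaC : forall c x, GRing.comm (iota c) x.
Hypothesis f_rel : forall x y, rels x y -> weval x = weval y.

Lemma weval_wcong x y : wcong x y -> weval x = weval y.
Proof.
elim=> {x y} //=; rewrite ?rmorph0 ?rmorph1.
- by move=> *; congruence.
- by move=> *; congruence.
- by move=> *; congruence.
- by move=> *; rewrite addrA.
- by move=> *; rewrite addrC.
- by move=> *; rewrite add0r.
- by move=> *; rewrite mulrA.
- by move=> *; rewrite mul1r.
- by move=> *; rewrite mulrDl.
- by move=> *; rewrite mulrDr.
- by move=> *; rewrite mul0r.
- by move=> *; rewrite rmorphD.
- by move=> *; rewrite rmorphM.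
- by move=> *; rewrite iotaC.
Qed.

Lemma pliftE w : plift (pclass w) = weval w.
Proof. by apply: weval_wcong; exact: repr_pclass. Qed.

Lemma plift_gen g : plift (pgen g) = f g.
Proof. exact: pliftE. Qed.

Lemma pliftD x y : plift (x + y) = plift x + plift y.
Proof.
elim/palgP: x => x; elim/palgP: y => y.
by rewrite -pclassD !pliftE.
Qed.

Lemma pliftM x y : plift (x * y) = plift x * plift y.
Proof.
elim/palgP: x => x; elim/palgP: y => y.
by rewrite -pclassM !pliftE.
Qed.

Lemma plift1 : plift 1 = 1.
Proof. by rewrite [1 in LHS]/(pclass _) pliftE /= rmorph1. Qed.

Lemma pliftZ c x : plift (c *: x) = iota c * plift x.
Proof.
elim/palgP: x => x; rewrite pliftE.
by rewrite -[c *: _]/(pscale _ _) pscaleE pliftE.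
Qed.

End Lift.

Lemma prel_eq x y : rels x y -> pclass x = pclass y.
Proof. by move=> xy; apply: pclass_eq; exact: WRel. Qed.

End PresentedAlgebra.

Arguments pgen {K G rels}.
Arguments pclass {K G rels}.

Record linop (K : pzRingType) (V : lmodType K) := LinOp {
  linop_fun :> V -> V;
  linop_linear : linear linop_fun }.

HB.instance Definition _ (K : pzRingType) (V : lmodType K) :=
  gen_eqMixin (linop V).
HB.instance Definition _ (K : pzRingType) (V : lmodType K) :=
  gen_choiceMixin (linop V).

Section LinearOperators.
Variables (K : comPzRingType) (V : lmodType K).
Implicit Types f g : linop V.

Lemma linopP f g : f =1 g -> f = g.
Proof.
case: f g => [f fl] [g gl] /= /funext fg; rewrite -{}fg in gl *.
by congr LinOp; exact: Prop_irrelevance.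
Qed.

HB.instance Definition _ f := GRing.isLinear.Build K V V *:%R f (linop_linear f).

Lemma linop_add_subproof f g : linear (fun v => f v + g v).
Proof. by move=> a u v; rewrite !linearP scalerDr addrACA. Qed.
Definition linop_add f g := LinOp (linop_add_subproof f g).

Lemma linop_opp_subproof f : linear (fun v => - f v).
Proof. by move=> a u v; rewrite linearP opprD scalerN. Qed.
Definition linop_opp f := LinOp (linop_opp_subproof f).

Lemma linop_zero_subproof : linear (fun _ : V => 0 : V).
Proof. by move=> a u v; rewrite scaler0 addr0. Qed.
Definition linop_zero := LinOp linop_zero_subproof.

Lemma linop_comp_subproof f g : linear (fun v => f (g v)).
Proof. by move=> a u v; rewrite !linearP. Qed.
Definition linop_comp f g := LinOp (linop_comp_subproof f g).

Lemma linop_id_subproof : linear (fun v : V => v).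
Proof. by []. Qed.
Definition linop_id := LinOp linop_id_subproof.

Lemma linop_addA : associative linop_add.
Proof. by move=> f g h; apply: linopP => v /=; rewrite addrA. Qed.
Lemma linop_addC : commutative linop_add.
Proof. by move=> f g; apply: linopP => v /=; rewrite addrC. Qed.
Lemma linop_add0 : left_id linop_zero linop_add.
Proof. by move=> f; apply: linopP => v /=; rewrite add0r. Qed.
Lemma linop_addN : left_inverse linop_zero linop_opp linop_add.
Proof. by move=> f; apply: linopP => v /=; rewrite addNr. Qed.
HB.instance Definition _ :=
  GRing.isZmodule.Build (linop V) linop_addA linop_addC linop_add0 linop_addN.

Lemma linop_compA : associative linop_comp.
Proof. by move=> f g h; exact: linopP. Qed.
Lemma linop_comp1 : left_id linop_id linop_comp.
Proof. by move=> f; exact: linopP. Qed.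
Lemma linop_compr1 : right_id linop_id linop_comp.
Proof. by move=> f; exact: linopP. Qed.
Lemma linop_compDl : left_distributive linop_comp +%R.
Proof. by move=> f g h; exact: linopP. Qed.
Lemma linop_compDr : right_distributive linop_comp +%R.
Proof. by move=> f g h; apply: linopP => v /=; rewrite linearD. Qed.
HB.instance Definition _ := GRing.Zmodule_isPzRing.Build (linop V)
  linop_compA linop_comp1 linop_compr1 linop_compDl linop_compDr.

Lemma linop_scalar_subproof (c : K) : linear (fun v : V => c *: v).
Proof. by move=> a u v; rewrite scalerDr !scalerA mulrC. Qed.
Definition linop_scalar c : linop V := LinOp (linop_scalar_subproof c).

Lemma linop_scalar_additive : zmod_morphism linop_scalar.
Proof. by move=> a b; apply: linopP => v /=; rewrite scalerBl. Qed.
Lemma linop_scalar_monoid : monoid_morphism linop_scalar.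
Proof.
split; first by apply: linopP => v /=; rewrite scale1r.
by move=> a b; apply: linopP => v /=; rewrite scalerA.
Qed.
HB.instance Definition _ :=
  GRing.isZmodMorphism.Build K (linop V) linop_scalar linop_scalar_additive.
HB.instance Definition _ :=
  GRing.isMonoidMorphism.Build K (linop V) linop_scalar linop_scalar_monoid.

Lemma linop_scalarC c f : GRing.comm (linop_scalar c) f.
Proof. by apply: linopP => v /=; rewrite linearZ. Qed.

End LinearOperators.

Inductive tword (K V W : Type) : Type :=
| TPure of V & W
| TZero
| TAdd of tword K V W & tword K V W
| TScale of K & tword K V W.

Arguments TPure {K V W}.
Arguments TZero {K V W}.

HB.instance Definition _ (K V W : Type) := gen_eqMixin (tword K V W).
HB.instance Definition _ (K V W : Type) := gen_choiceMixin (tword K V W).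

Section TensorProduct.
Variables (K : comNzRingType) (V W : lmodType K).

(* The least congruence whose quotient is a K-module in which [TPure] is
   K-bilinear. *)
Inductive tcong : tword K V W -> tword K V W -> Prop :=
| TRefl x : tcong x x
| TSym x y of tcong x y : tcong y x
| TTrans x y z of tcong x y & tcong y z : tcong x z
| TCAdd x x' y y' of tcong x x' & tcong y y' : tcong (TAdd x y) (TAdd x' y')
| TCScale c x x' of tcong x x' : tcong (TScale c x) (TScale c x')
| TAddA x y z : tcong (TAdd x (TAdd y z)) (TAdd (TAdd x y) z)
| TAddC x y : tcong (TAdd x y) (TAdd y x)
| TAdd0 x : tcong (TAdd TZero x) x
| TScale0 x : tcong (TScale 0 x) TZero
| TScale1 x : tcong (TScale 1 x) x
| TScaleA a b x : tcong (TScale a (TScale b x)) (TScale (a * b) x)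
| TScaleDr c x y : tcong (TScale c (TAdd x y)) (TAdd (TScale c x) (TScale c y))
| TScaleDl a b x : tcong (TScale (a + b) x) (TAdd (TScale a x) (TScale b x))
| TPureDl v v' w : tcong (TPure (v + v') w) (TAdd (TPure v w) (TPure v' w))
| TPureDr v w w' : tcong (TPure v (w + w')) (TAdd (TPure v w) (TPure v w'))
| TPureZl c v w : tcong (TPure (c *: v) w) (TScale c (TPure v w))
| TPureZr c v w : tcong (TPure v (c *: w)) (TScale c (TPure v w)).

Definition tequiv : rel (tword K V W) := fun x y => `[< tcong x y >].

Lemma tequiv_refl : reflexive tequiv.
Proof. by move=> x; apply/asboolP; exact: TRefl. Qed.

Lemma tequiv_sym : symmetric tequiv.
Proof. by move=> x y; apply/asboolP/asboolP; exact: TSym. Qed.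

Lemma tequiv_trans : transitive tequiv.
Proof.
by move=> y x z /asboolP xy /asboolP yz; apply/asboolP; exact: TTrans yz.
Qed.

Canonical tequiv_rel := EquivRel tequiv tequiv_refl tequiv_sym tequiv_trans.

Definition tensor : Type := {eq_quot tequiv_rel}.
HB.instance Definition _ := Choice.on tensor.
HB.instance Definition _ := EqQuotient.on tensor.

Definition tclass (w : tword K V W) : tensor := \pi_tensor w.

Lemma tclass_eq x y : tcong x y -> tclass x = tclass y.
Proof. by move=> xy; apply/eqmodP/asboolP. Qed.

Lemma tclassP x y : tclass x = tclass y -> tcong x y.
Proof. by move=> /eqmodP/asboolP. Qed.

Lemma repr_tclass x : tcong (repr (tclass x)) x.
Proof. by apply: tclassP; rewrite /tclass reprK. Qed.

Lemma tensorP (P : tensor -> Prop) : (forall w, P (tclass w)) -> forall x, P x.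
Proof. by move=> Pw x; rewrite -[x]reprK; exact: Pw. Qed.

Definition tadd (x y : tensor) := tclass (TAdd (repr x) (repr y)).
Definition tscale (c : K) (x : tensor) := tclass (TScale c (repr x)).

Lemma taddE x y : tadd (tclass x) (tclass y) = tclass (TAdd x y).
Proof. by apply: tclass_eq; apply: TCAdd; exact: repr_tclass. Qed.

Lemma tscaleE c x : tscale c (tclass x) = tclass (TScale c x).
Proof. by apply: tclass_eq; apply: TCScale; exact: repr_tclass. Qed.

Lemma taddA : associative tadd.
Proof.
elim/tensorP=> x; elim/tensorP=> y; elim/tensorP=> z.
by rewrite !taddE; apply: tclass_eq; exact: TAddA.
Qed.

Lemma taddC : commutative tadd.
Proof.
elim/tensorP=> x; elim/tensorP=> y.
by rewrite !taddE; apply: tclass_eq; exact: TAddC.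
Qed.

Lemma tadd0 : left_id (tclass TZero) tadd.
Proof. by elim/tensorP=> x; rewrite !taddE; apply: tclass_eq; exact: TAdd0. Qed.

Lemma tscale1 : left_id 1 tscale.
Proof.
by elim/tensorP=> x; rewrite tscaleE; apply: tclass_eq; exact: TScale1.
Qed.

Lemma tscaleDl x : {morph tscale^~ x : a b / a + b >-> tadd a b}.
Proof.
move=> a b; elim/tensorP: x => x.
by rewrite !tscaleE !taddE; apply: tclass_eq; exact: TScaleDl.
Qed.

Lemma taddN : left_inverse (tclass TZero) (tscale (-1)) tadd.
Proof.
move=> x; rewrite -{2}(tscale1 x) -tscaleDl addNr.
by elim/tensorP: x => x; rewrite tscaleE; apply: tclass_eq; exact: TScale0.
Qed.

HB.instance Definition _ :=
  GRing.isZmodule.Build tensor taddA taddC tadd0 taddN.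

Lemma tscaleA a b x : tscale a (tscale b x) = tscale (a * b) x.
Proof.
elim/tensorP: x => x.
by rewrite !tscaleE; apply: tclass_eq; exact: TScaleA.
Qed.

Lemma tscaleDr : right_distributive tscale +%R.
Proof.
move=> c; elim/tensorP=> x; elim/tensorP=> y.
rewrite /GRing.add /= !(taddE, tscaleE); apply: tclass_eq; exact: TScaleDr.
Qed.

HB.instance Definition _ :=
  GRing.Zmodule_isLmodule.Build K tensor tscaleA tscale1 tscaleDr tscaleDl.

Definition tpure (v : V) (w : W) : tensor := tclass (TPure v w).

Lemma tclassD x y : tclass (TAdd x y) = tclass x + tclass y.
Proof. by rewrite [RHS]taddE. Qed.

Lemma tclassZ c x : tclass (TScale c x) = c *: tclass x.
Proof. by rewrite [RHS]tscaleE. Qed.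

Lemma tpureDl v v' w : tpure (v + v') w = tpure v w + tpure v' w.
Proof. by rewrite -tclassD; apply: tclass_eq; exact: TPureDl. Qed.

Lemma tpureDr v w w' : tpure v (w + w') = tpure v w + tpure v w'.
Proof. by rewrite -tclassD; apply: tclass_eq; exact: TPureDr. Qed.

Lemma tpureZl c v w : tpure (c *: v) w = c *: tpure v w.
Proof. by rewrite -tclassZ; apply: tclass_eq; exact: TPureZl. Qed.

Lemma tpureZr c v w : tpure v (c *: w) = c *: tpure v w.
Proof. by rewrite -tclassZ; apply: tclass_eq; exact: TPureZr. Qed.

Lemma tpure_linearl w : linear (tpure^~ w).
Proof. by move=> c u v; rewrite tpureDl tpureZl. Qed.

Lemma tpure_linearr v : linear (tpure v).
Proof. by move=> c u w; rewrite tpureDr tpureZr. Qed.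

Lemma tensor_ind (P : tensor -> Prop) :
  (forall v w, P (tpure v w)) -> (forall c x, P x -> P (c *: x)) ->
  (forall x y, P x -> P y -> P (x + y)) -> forall x, P x.
Proof.
move=> Pp PZ PD; elim/tensorP; elim=> [v w||x Px y Py|c x Px].
- exact: Pp.
- have -> : tclass TZero = 0 *: tpure 0 0 :> tensor by rewrite scale0r.
  by apply: PZ; exact: Pp.
- by rewrite tclassD; exact: PD.
- by rewrite tclassZ; exact: PZ.
Qed.

Section TensorLift.
Variables (Z : lmodType K) (f : V -> W -> Z).

Fixpoint teval (x : tword K V W) : Z :=
  match x with
  | TPure v w => f v w
  | TZero => 0
  | TAdd x y => teval x + teval y
  | TScale c x => c *: teval x
  end.

Definition tlift (x : tensor) : Z := teval (repr x).

Hypothesis f_linearl : forall w, linear (f^~ w).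
Hypothesis f_linearr : forall v, linear (f v).

Lemma teval_tcong x y : tcong x y -> teval x = teval y.
Proof.
elim=> {x y} //=.
- by move=> *; congruence.
- by move=> *; congruence.
- by move=> *; congruence.
- by move=> *; rewrite addrA.
- by move=> *; rewrite addrC.
- by move=> *; rewrite add0r.
- by move=> *; rewrite scale0r.
- by move=> *; rewrite scale1r.
- by move=> *; rewrite scalerA.
- by move=> *; rewrite scalerDr.
- by move=> *; rewrite scalerDl.
- by move=> v v' w; rewrite (linear_fD (f_linearl w)).
- by move=> v w w'; rewrite (linear_fD (f_linearr v)).
- by move=> c v w; rewrite (linear_fZ (f_linearl w)).
- by move=> c v w; rewrite (linear_fZ (f_linearr v)).
Qed.

Lemma tlift_class x : tlift (tclass x) = teval x.
Proof. by apply: teval_tcong; exact: repr_tclass. Qed.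

Lemma tlift_pure v w : tlift (tpure v w) = f v w.
Proof. exact: tlift_class. Qed.

Lemma tlift_linear : linear tlift.
Proof.
move=> c; elim/tensorP=> x; elim/tensorP=> y.
by rewrite -tclassZ -tclassD !tlift_class.
Qed.

Lemma tliftD x y : tlift (x + y) = tlift x + tlift y.
Proof. exact: linear_fD tlift_linear _ _. Qed.

Lemma tliftZ c x : tlift (c *: x) = c *: tlift x.
Proof. by elim/tensorP: x => x; rewrite -tclassZ !tlift_class. Qed.

End TensorLift.

End TensorProduct.

Notation "v ⊗ w" := (tpure v w) (at level 39, left associativity) : ring_scope.

(* The bilinear extension of ((a ⊗ b), (v ⊗ w)) |-> (F a v) ⊗ (G b w). *)
Definition tact (K : comNzRingType) (A B V W V' W' : lmodType K)
    (F : A -> V -> V') (G : B -> W -> W')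
    (x : tensor A B) (y : tensor V W) : tensor V' W' :=
  tlift (fun a b => tlift (fun v w => F a v ⊗ G b w) y) x.

Section TensorAction.
Variables (K : comNzRingType) (A B V W V' W' : lmodType K).
Variables (F : A -> V -> V') (G : B -> W -> W').
Hypothesis F_linearl : forall v, linear (F^~ v).
Hypothesis F_linearr : forall a, linear (F a).
Hypothesis G_linearl : forall w, linear (G^~ w).
Hypothesis G_linearr : forall b, linear (G b).
Local Notation tact := (tact F G).

Let in_l a b w : linear (fun v => F a v ⊗ G b w).
Proof. by move=> c u v; rewrite F_linearr tpure_linearl. Qed.
Let in_r a b v : linear (fun w => F a v ⊗ G b w).
Proof. by move=> c u w; rewrite G_linearr tpure_linearr. Qed.

Let outE a b v w :
  tlift (fun v w => F a v ⊗ G b w) (v ⊗ w) = F a v ⊗ G b w.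
Proof. exact: tlift_pure (in_l a b) (in_r a b) _ _. Qed.

Let outD a b y y' : tlift (fun v w => F a v ⊗ G b w) (y + y') =
  tlift (fun v w => F a v ⊗ G b w) y + tlift (fun v w => F a v ⊗ G b w) y'.
Proof. exact: tliftD (in_l a b) (in_r a b) _ _. Qed.

Let outZ a b c y : tlift (fun v w => F a v ⊗ G b w) (c *: y) =
  c *: tlift (fun v w => F a v ⊗ G b w) y.
Proof. exact: tliftZ (in_l a b) (in_r a b) _ _. Qed.

Let out_l y b : linear (fun a => tlift (fun v w => F a v ⊗ G b w) y).
Proof.
move=> c a a'; elim/tensor_ind: y => [v w|d y IH|y y' IH IH'].
- by rewrite !outE F_linearl tpure_linearl.
- by rewrite !outZ IH scalerDr !scalerA mulrC.
- by rewrite !outD IH IH' scalerDr addrACA.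
Qed.

Let out_r y a : linear (fun b => tlift (fun v w => F a v ⊗ G b w) y).
Proof.
move=> c b b'; elim/tensor_ind: y => [v w|d y IH|y y' IH IH'].
- by rewrite !outE G_linearl tpure_linearr.
- by rewrite !outZ IH scalerDr !scalerA mulrC.
- by rewrite !outD IH IH' scalerDr addrACA.
Qed.

Lemma tact_pure a b v w : tact (a ⊗ b) (v ⊗ w) = F a v ⊗ G b w.
Proof. by rewrite /tact tlift_pure// outE. Qed.

Lemma tact_linearl y : linear (tact^~ y).
Proof. exact: tlift_linear (out_l y) (out_r y). Qed.

Lemma tact_linearr x : linear (tact x).
Proof.
move=> c y y'; elim/tensor_ind: x => [a b|d x IH|x x' IH IH'].
- by rewrite /tact !tlift_pure// outD outZ.
- by rewrite /tact !tliftZ// -/(tact x _) IH scalerDr !scalerA mulrC.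
- by rewrite /tact !tliftD// -![tlift _ _]/(tact _ _) IH IH' scalerDr addrACA.
Qed.

Lemma tactDl x x' y : tact (x + x') y = tact x y + tact x' y.
Proof. exact: linear_fD (tact_linearl y) _ _. Qed.

Lemma tactDr x y y' : tact x (y + y') = tact x y + tact x y'.
Proof. exact: linear_fD (tact_linearr x) _ _. Qed.

Lemma tactZl c x y : tact (c *: x) y = c *: tact x y.
Proof. exact: linear_fZ (tact_linearl y) _ _. Qed.

Lemma tactZr c x y : tact x (c *: y) = c *: tact x y.
Proof. exact: linear_fZ (tact_linearr x) _ _. Qed.

End TensorAction.

Section TensorAlgebra.
Variables (K : comNzRingType) (A B : algType K).
Implicit Types x y z : tensor A B.

Definition tmul : tensor A B -> tensor A B -> tensor A B :=
  tact ( *%R : A -> A -> A) ( *%R : B -> B -> B).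

Lemma mul_linearl (C : algType K) (b : C) : linear ( *%R^~ b).
Proof. by move=> c x y; rewrite mulrDl scalerAl. Qed.
Lemma mul_linearr (C : algType K) (b : C) : linear ( *%R b).
Proof. by move=> c x y; rewrite mulrDr scalerAr. Qed.

Let mulE a a' b b' : tmul (a ⊗ b) (a' ⊗ b') = (a * a') ⊗ (b * b').
Proof. by apply: tact_pure; (exact: mul_linearl || exact: mul_linearr). Qed.
Let mulDl x y z : tmul (x + y) z = tmul x z + tmul y z.
Proof. by apply: tactDl; (exact: mul_linearl || exact: mul_linearr). Qed.
Let mulDr x y z : tmul x (y + z) = tmul x y + tmul x z.
Proof. by apply: tactDr; (exact: mul_linearl || exact: mul_linearr). Qed.
Let mulZl c x y : tmul (c *: x) y = c *: tmul x y.
Proof. by apply: tactZl; (exact: mul_linearl || exact: mul_linearr). Qed.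
Let mulZr c x y : tmul x (c *: y) = c *: tmul x y.
Proof. by apply: tactZr; (exact: mul_linearl || exact: mul_linearr). Qed.

Lemma tmulA : associative tmul.
Proof.
move=> x y z.
elim/tensor_ind: x => [a b|c x IH|x x' IH IH'].
- elim/tensor_ind: y => [a' b'|c y IH|y y' IH IH'].
  + elim/tensor_ind: z => [a'' b''|c z IH|z z' IH IH'].
    * by rewrite !mulE !mulrA.
    * by rewrite !mulZr IH.
    * by rewrite !mulDr IH IH'.
  + by rewrite !(mulZl, mulZr) IH.
  + by rewrite !(mulDl, mulDr) IH IH'.
- by rewrite !mulZl IH.
- by rewrite !mulDl IH IH'.
Qed.

Lemma tmul1 : left_id (1 ⊗ 1) tmul.
Proof.
elim/tensor_ind=> [a b|c x IH|x y IH IH'].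
- by rewrite mulE !mul1r.
- by rewrite mulZr IH.
- by rewrite mulDr IH IH'.
Qed.

Lemma tmulr1 : right_id (1 ⊗ 1) tmul.
Proof.
elim/tensor_ind=> [a b|c x IH|x y IH IH'].
- by rewrite mulE !mulr1.
- by rewrite mulZl IH.
- by rewrite mulDl IH IH'.
Qed.

HB.instance Definition _ := GRing.Zmodule_isPzRing.Build (tensor A B)
  tmulA tmul1 tmulr1 mulDl mulDr.

Lemma tensor_mulE (a a' : A) (b b' : B) :
  a ⊗ b * (a' ⊗ b') = (a * a') ⊗ (b * b').
Proof. exact: mulE. Qed.

Lemma tensor_scalerAl c x y : c *: (x * y) = (c *: x) * y.
Proof. by rewrite [RHS]mulZl. Qed.

Lemma tensor_scalerAr c x y : c *: (x * y) = x * (c *: y).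
Proof. by rewrite [RHS]mulZr. Qed.

Definition tensor_scalar (c : K) : tensor A B := c *: (1 : tensor A B).

Lemma tensor_scalar_additive : zmod_morphism tensor_scalar.
Proof. by move=> a b; rewrite /tensor_scalar scalerBl. Qed.
Lemma tensor_scalar_monoid : monoid_morphism tensor_scalar.
Proof.
split; first by rewrite /tensor_scalar scale1r.
by move=> a b; rewrite /tensor_scalar -tensor_scalerAl mul1r scalerA.
Qed.
HB.instance Definition _ := GRing.isZmodMorphism.Build K (tensor A B)
  tensor_scalar tensor_scalar_additive.
HB.instance Definition _ := GRing.isMonoidMorphism.Build K (tensor A B)
  tensor_scalar tensor_scalar_monoid.

Lemma tensor_scalarC c x : GRing.comm (tensor_scalar c) x.
Proof.
by rewrite /GRing.comm -tensor_scalerAl -tensor_scalerAr mul1r mulr1.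
Qed.

End TensorAlgebra.

Local Notation "x %:C" := (real_complex _ x) : ring_scope.

(* The base field is R[i], the complex numbers.  [UK] and [UKi] stand for
   e^{hH/4} and e^{-hH/4}: the relations UqHK, UqKXp and UqKXm follow formally
   from [H, X] = +-2 X, and uqmodule below makes [UK] act as the exponential.
   The antipode is omitted, as neither module algebras nor invariants use it. *)
Variant uqgen := UH | UXp | UXm | UK | UKi.

Section QuantumSl2.
Variables (R : realType) (h : R).

Notation "''H'" := (Gen UH) : word_scope.
Notation "''X+'" := (Gen UXp) : word_scope.
Notation "''X-'" := (Gen UXm) : word_scope.
Notation "''K'" := (Gen UK) : word_scope.
Notation "''K-'" := (Gen UKi) : word_scope.

Inductive uq_rel : word R[i] uqgen -> word R[i] uqgen -> Prop :=
| UqHXp : uq_rel ('H * 'X+ - 'X+ * 'H) (2 *: 'X+)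
| UqHXm : uq_rel ('H * 'X- - 'X- * 'H) ((-2) *: 'X-)
| UqXpXm : uq_rel ('X+ * 'X- - 'X- * 'X+)
    ((expR (h / 2) - expR (- (h / 2)))%:C^-1 *: ('K * 'K - 'K- * 'K-))
| UqKKi : uq_rel ('K * 'K-) (Scal 1)
| UqKiK : uq_rel ('K- * 'K) (Scal 1)
| UqHK : uq_rel ('H * 'K) ('K * 'H)
| UqKXp : uq_rel ('K * 'X+) ((expR (h / 2))%:C *: ('X+ * 'K))
| UqKXm : uq_rel ('K * 'X-) ((expR (- (h / 2)))%:C *: ('X- * 'K)).

Definition Uq : Type := palg uq_rel.
HB.instance Definition _ := Choice.on Uq.
HB.instance Definition _ := GRing.PzRing.on Uq.
HB.instance Definition _ := GRing.Lmodule.on Uq.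

Definition counit_gen (g : uqgen) : R[i] :=
  match g with UH | UXp | UXm => 0 | UK | UKi => 1 end.

Definition counit (x : Uq) : R[i] := plift idfun counit_gen x.

Lemma counit_rel x y : uq_rel x y ->
  weval idfun counit_gen x = weval idfun counit_gen y.
Proof.
by case=> /=; rewrite ?(mulr0, mul0r, mulr1, mul1r, addr0, addrN).
Qed.

Let idC (c x : R[i]) : GRing.comm (idfun c) x.
Proof. exact: mulrC. Qed.

Lemma counit1 : counit 1 = 1.
Proof. exact: plift1 idC counit_rel. Qed.

Lemma counitD x y : counit (x + y) = counit x + counit y.
Proof. exact: pliftD idC counit_rel _ _. Qed.

Lemma counitM x y : counit (x * y) = counit x * counit y.
Proof. exact: pliftM idC counit_rel _ _. Qed.

Lemma counitZ c x : counit (c *: x) = c * counit x.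
Proof. exact: pliftZ idC counit_rel _ _. Qed.

Lemma Uq_neq0 : (1 : Uq) != 0.
Proof.
apply/eqP => /(congr1 counit); rewrite counit1 -[0](scale0r (1 : Uq)) counitZ mul0r.
by apply/eqP; exact: oner_neq0.
Qed.

HB.instance Definition _ := GRing.PzSemiRing_isNonZero.Build Uq Uq_neq0.
HB.instance Definition _ :=
  GRing.Lmodule_isLalgebra.Build R[i] Uq (@pscaleAl _ _ _).
HB.instance Definition _ :=
  GRing.Lalgebra_isAlgebra.Build R[i] Uq (@pscaleAr _ _ _).

Definition uH : Uq := pgen UH.
Definition uXp : Uq := pgen UXp.
Definition uXm : Uq := pgen UXm.
Definition uK : Uq := pgen UK.
Definition uKi : Uq := pgen UKi.

Lemma counit_H : counit uH = 0.
Proof. exact: plift_gen idC counit_rel _. Qed.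
Lemma counit_Xp : counit uXp = 0.
Proof. exact: plift_gen idC counit_rel _. Qed.
Lemma counit_Xm : counit uXm = 0.
Proof. exact: plift_gen idC counit_rel _. Qed.
Lemma counit_K : counit uK = 1.
Proof. exact: plift_gen idC counit_rel _. Qed.
Lemma counit_Ki : counit uKi = 1.
Proof. exact: plift_gen idC counit_rel _. Qed.

Let classN (x y : word R[i] uqgen) :
  pclass (x - y)%W = (pclass x : Uq) - pclass y.
Proof. by rewrite pclassD pclassM pclassS scaleN1r mulN1r. Qed.

Let classZ c (x : word R[i] uqgen) : pclass (c *: x)%W = c *: (pclass x : Uq).
Proof. by rewrite pclassM pclassS -pscaleAl mul1r. Qed.

Lemma uq_HXp : uH * uXp - uXp * uH = 2 *: uXp.
Proof. by have := prel_eq UqHXp; rewrite classN classZ !pclassM. Qed.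
Lemma uq_HXm : uH * uXm - uXm * uH = (-2) *: uXm.
Proof. by have := prel_eq UqHXm; rewrite classN classZ !pclassM. Qed.
Lemma uq_XpXm : uXp * uXm - uXm * uXp =
  (expR (h / 2) - expR (- (h / 2)))%:C^-1 *: (uK * uK - uKi * uKi).
Proof. by have := prel_eq UqXpXm; rewrite classN classZ classN !pclassM. Qed.
Lemma uq_KKi : uK * uKi = 1.
Proof. by have := prel_eq UqKKi; rewrite pclassM pclassS scale1r. Qed.
Lemma uq_KiK : uKi * uK = 1.
Proof. by have := prel_eq UqKiK; rewrite pclassM pclassS scale1r. Qed.
Lemma uq_HK : uH * uK = uK * uH.
Proof. by have := prel_eq UqHK; rewrite !pclassM. Qed.
Lemma uq_KXp : uK * uXp = (expR (h / 2))%:C *: (uXp * uK).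
Proof. by have := prel_eq UqKXp; rewrite classZ !pclassM. Qed.
Lemma uq_KXm : uK * uXm = (expR (- (h / 2)))%:C *: (uXm * uK).
Proof. by have := prel_eq UqKXm; rewrite classZ !pclassM. Qed.

Lemma expR_realC (x : R) : (expR x)%:C * (expR (- x))%:C = 1 :> R[i].
Proof. by rewrite -rmorphM -expRD subrr expR0. Qed.

Lemma uq_HKi : uH * uKi = uKi * uH.
Proof.
rewrite -[uH in LHS]mul1r -uq_KiK -[uKi * uK * _]mulrA -uq_HK.
by rewrite -!mulrA uq_KKi mulr1.
Qed.

Let KiX x c : uK * x = (expR c)%:C *: (x * uK) ->
  uKi * x = (expR (- c))%:C *: (x * uKi).
Proof.
move=> Kx.
have xK : x * uK = (expR (- c))%:C *: (uK * x).
  by rewrite Kx scalerA mulrC expR_realC scale1r.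
rewrite -[x in LHS]mulr1 -uq_KKi [x * _]mulrA xK -scalerAl -scalerAr.
by rewrite !mulrA uq_KiK mul1r.
Qed.

Lemma uq_KiXp : uKi * uXp = (expR (- (h / 2)))%:C *: (uXp * uKi).
Proof. exact: KiX uq_KXp. Qed.
Lemma uq_KiXm : uKi * uXm = (expR (h / 2))%:C *: (uXm * uKi).
Proof. by rewrite (KiX uq_KXm) opprK. Qed.

Definition coproduct_gen (g : uqgen) : tensor Uq Uq :=
  match g with
  | UH => uH ⊗ 1 + 1 ⊗ uH
  | UXp => uXp ⊗ uK + uKi ⊗ uXp
  | UXm => uXm ⊗ uK + uKi ⊗ uXm
  | UK => uK ⊗ uK
  | UKi => uKi ⊗ uKi
  end.

Definition coproduct (x : Uq) : tensor Uq Uq :=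
  plift (@tensor_scalar _ Uq Uq) coproduct_gen x.

Let tscal c (x : tensor Uq Uq) : tensor_scalar Uq Uq c * x = c *: x.
Proof. by rewrite /tensor_scalar -tensor_scalerAl mul1r. Qed.

Let tpureBl (x x' y : Uq) : (x - x') ⊗ y = x ⊗ y - x' ⊗ y.
Proof. by rewrite -scaleN1r tpureDl tpureZl scaleN1r. Qed.
Let tpureBr (x y y' : Uq) : x ⊗ (y - y') = x ⊗ y - x ⊗ y'.
Proof. by rewrite -scaleN1r tpureDr tpureZr scaleN1r. Qed.

Let br (A : pzRingType) (x y : A) : A := x * y - y * x.

Let brDl (A : pzRingType) (x x' y : A) : br (x + x') y = br x y + br x' y.
Proof. by rewrite /br mulrDl mulrDr opprD addrACA. Qed.
Let brDr (A : pzRingType) (x y y' : A) : br x (y + y') = br x y + br x y'.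
Proof. by rewrite /br mulrDl mulrDr opprD addrACA. Qed.

Let br_primitive (a x y : Uq) :
  br (a ⊗ 1 + 1 ⊗ a) (x ⊗ y) = br a x ⊗ y + x ⊗ br a y.
Proof.
by rewrite brDl /br !tensor_mulE !(mul1r, mulr1) tpureBl tpureBr.
Qed.

Lemma coproduct_rel x y : uq_rel x y ->
  weval (@tensor_scalar _ Uq Uq) coproduct_gen x =
  weval (@tensor_scalar _ Uq Uq) coproduct_gen y.
Proof.
have HK : br uH uK = 0 by rewrite /br uq_HK subrr.
have HKi : br uH uKi = 0 by rewrite /br uq_HKi subrr.
have t0l (u : Uq) : 0 ⊗ u = 0 by rewrite -(scale0r 0) tpureZl scale0r.
have t0r (u : Uq) : u ⊗ 0 = 0 by rewrite -(scale0r 0) tpureZr scale0r.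
case=> /=; rewrite ?tscal ?scaleN1r ?scale1r.
- rewrite -/(br _ _) brDr !br_primitive HK HKi t0l t0r addr0 add0r.
  by rewrite /br uq_HXp tpureZl tpureZr scalerDr.
- rewrite -/(br _ _) brDr !br_primitive HK HKi t0l t0r addr0 add0r.
  by rewrite /br uq_HXm tpureZl tpureZr scalerDr.
- rewrite -/(br _ _) brDl !brDr.
  have -> : br (uXp ⊗ uK) (uKi ⊗ uXm) = 0.
    rewrite /br !tensor_mulE uq_KXm uq_KiXp tpureZl tpureZr.
    by rewrite subrr.
  have -> : br (uKi ⊗ uXp) (uXm ⊗ uK) = 0.
    rewrite /br !tensor_mulE uq_KXp uq_KiXm tpureZl tpureZr.
    by rewrite subrr.
  rewrite addr0 add0r /br !tensor_mulE -tpureBl -tpureBr uq_XpXm.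
  rewrite tpureZl tpureZr -scalerDr; congr (_ *: _).
  by rewrite tpureBl tpureBr addrA subrK.
- by rewrite tensor_mulE uq_KKi /tensor_scalar scale1r.
- by rewrite tensor_mulE uq_KiK /tensor_scalar scale1r.
- by rewrite mulrDl mulrDr !tensor_mulE uq_HK !(mul1r, mulr1).
- rewrite mulrDl mulrDr !tensor_mulE uq_KXp tpureZl tpureZr.
  by rewrite uq_KKi uq_KiK scalerDr.
- rewrite mulrDl mulrDr !tensor_mulE uq_KXm tpureZl tpureZr.
  by rewrite uq_KKi uq_KiK scalerDr.
Qed.

Let tC c (x : tensor Uq Uq) : GRing.comm (tensor_scalar Uq Uq c) x.
Proof. exact: tensor_scalarC. Qed.

Lemma coproduct1 : coproduct 1 = 1.
Proof. exact: plift1 tC coproduct_rel. Qed.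
Lemma coproductD x y : coproduct (x + y) = coproduct x + coproduct y.
Proof. exact: pliftD tC coproduct_rel _ _. Qed.
Lemma coproductM x y : coproduct (x * y) = coproduct x * coproduct y.
Proof. exact: pliftM tC coproduct_rel _ _. Qed.
Lemma coproductZ c x : coproduct (c *: x) = c *: coproduct x.
Proof. by rewrite -tscal; exact: pliftZ tC coproduct_rel _ _. Qed.
Lemma coproduct_H : coproduct uH = uH ⊗ 1 + 1 ⊗ uH.
Proof. exact: plift_gen tC coproduct_rel _. Qed.
Lemma coproduct_Xp : coproduct uXp = uXp ⊗ uK + uKi ⊗ uXp.
Proof. exact: plift_gen tC coproduct_rel _. Qed.
Lemma coproduct_Xm : coproduct uXm = uXm ⊗ uK + uKi ⊗ uXm.
Proof. exact: plift_gen tC coproduct_rel _. Qed.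
Lemma coproduct_K : coproduct uK = uK ⊗ uK.
Proof. exact: plift_gen tC coproduct_rel _. Qed.
Lemma coproduct_Ki : coproduct uKi = uKi ⊗ uKi.
Proof. exact: plift_gen tC coproduct_rel _. Qed.

(* [uH] acts diagonally with integer eigenvalues, so e^{hH/4} is the operator
   that multiplies the eigenvectors of eigenvalue n by e^{hn/4}. *)
Record uqmodule (V : lmodType R[i]) := UqModule {
  uact :> Uq -> V -> V;
  uact_linearl : forall v, linear (uact^~ v);
  uact_linearr : forall x, linear (uact x);
  uact1 : forall v, uact 1 v = v;
  uactM : forall x y v, uact (x * y) v = uact x (uact y v);
  uact_diag : forall v, exists s : seq (int * V),
    (forall p, p \in s -> uact uH p.2 = p.1%:~R *: p.2) /\
    v = \sum_(p <- s) p.2;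
  uact_K : forall (n : int) v, uact uH v = n%:~R *: v ->
    uact uK v = (expR (h * n%:~R / 4))%:C *: v }.

Definition uq_invariant (V : lmodType R[i]) (M : uqmodule V) (v : V) : Prop :=
  forall x : Uq, M x v = counit x *: v.

(* Sums of joint eigenvectors of [H] and [K], with eigenvalues n and
   k n. *)
Section JointWeights.
Variables (V : lmodType R[i]) (k : int -> R[i]) (oH oK : V -> V).
Hypothesis oH_linear : linear oH.
Hypothesis oK_linear : linear oK.

Definition joint_weight (n : int) (v : V) : Prop :=
  oH v = n%:~R *: v /\ oK v = k n *: v.

Definition joint_sum (v : V) : Prop := exists s : seq (int * V),
  (forall p, p \in s -> joint_weight p.1 p.2) /\ v = \sum_(p <- s) p.2.

Let oHZ c v : oH (c *: v) = c *: oH v.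
Proof. exact: linear_fZ. Qed.
Let oKZ c v : oK (c *: v) = c *: oK v.
Proof. exact: linear_fZ. Qed.
Let oHD u v : oH (u + v) = oH u + oH v.
Proof. exact: linear_fD. Qed.
Let oKD u v : oK (u + v) = oK u + oK v.
Proof. exact: linear_fD. Qed.

Lemma joint_sum_weight n v : joint_weight n v -> joint_sum v.
Proof.
move=> nv; exists [:: (n, v)]; rewrite big_seq1; split=> // p.
by rewrite inE => /eqP->.
Qed.

Lemma joint_sum0 : joint_sum 0.
Proof. by exists [::]; rewrite big_nil. Qed.

Lemma joint_sumD u v : joint_sum u -> joint_sum v -> joint_sum (u + v).
Proof.
move=> [s [sP ->]] [t [tP ->]]; exists (s ++ t); rewrite big_cat; split=> // p.
by rewrite mem_cat => /orP[/sP|/tP].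
Qed.

Lemma joint_sumZ c v : joint_sum v -> joint_sum (c *: v).
Proof.
move=> [s [sP ->]]; exists [seq (p.1, c *: p.2) | p <- s].
split; last by rewrite big_map scaler_sumr.
move=> _ /mapP[p /sP[pH pK] ->]; split=> /=.
- by rewrite oHZ pH !scalerA mulrC.
- by rewrite oKZ pK !scalerA mulrC.
Qed.

Lemma joint_sum_ind (P : V -> Prop) : P 0 ->
  (forall u v, P u -> P v -> P (u + v)) ->
  (forall n v, joint_weight n v -> P v) -> forall v, joint_sum v -> P v.
Proof.
move=> P0 PD Pw _ [s [sP ->]]; elim: s sP => [|p s IH] sP.
  by rewrite big_nil.
rewrite big_cons; apply: PD; last first.
  by apply: IH => p' p's; apply: sP; rewrite inE p's orbT.
by apply: (Pw p.1); apply: sP; rewrite inE eqxx.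
Qed.

Lemma joint_sum_K n v : joint_sum v -> oH v = n%:~R *: v -> oK v = k n *: v.
Proof.
case=> s; have [m] := ubnP (size s); elim: m => // m IH in s v *.
case: s => [|p s] /= sm [sP ->] nv.
  have -> : oK (\sum_(p <- [::] : seq (int * V)) p.2) = 0.
    by rewrite big_nil -(scale0r 0) oKZ !scale0r.
  by rewrite big_nil scaler0.
have [pH pK] : joint_weight p.1 p.2 by apply: sP; rewrite inE eqxx.
move: nv; rewrite big_cons; set w := \sum_(p <- s) p.2 => nv.
have s'P p' : p' \in s -> joint_weight p'.1 p'.2.
  by move=> p's; apply: sP; rewrite inE p's orbT.
have [pn|pn] := eqVneq p.1 n.
  rewrite oKD pK pn scalerDr; congr (_ + _); apply: (IH s) => //.
  by move: nv; rewrite oHD pH pn scalerDr => /addrI.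
have mn0 : (n - p.1)%:~R != 0 :> R[i].
  by rewrite intr_eq0 subr_eq0 eq_sym.
have wE : (n - p.1)%:~R *: (p.2 + w) =
          \sum_(p' <- [seq (p'.1, (p'.1 - p.1)%:~R *: p'.2) | p' <- s]) p'.2.
  rewrite rmorphB scalerBl -nv oHD pH big_map scalerDr opprD addrACA addrN add0r.
  rewrite /w scaler_sumr.
  have -> : oH (\sum_(j <- s) j.2) = \sum_(j <- s) j.1%:~R *: j.2.
    elim: s s'P {sP nv w sm} => [|p' s IHs] s'P.
      by rewrite !big_nil -(scale0r 0) oHZ !scale0r.
    rewrite !big_cons oHD IHs; last first.
      by move=> q qs; apply: s'P; rewrite inE qs orbT.
    by have [-> _] := s'P p' (mem_head _ _).
  by rewrite -sumrB; apply: eq_bigr => p' _; rewrite rmorphB scalerBl.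
have : oK ((n - p.1)%:~R *: (p.2 + w)) = k n *: ((n - p.1)%:~R *: (p.2 + w)).
  apply: (IH [seq (p'.1, (p'.1 - p.1)%:~R *: p'.2) | p' <- s]).
  - by rewrite size_map.
  - split=> // _ /mapP[p' /s'P[p'H p'K] ->]; split=> /=.
    + by rewrite oHZ p'H !scalerA mulrC.
    + by rewrite oKZ p'K !scalerA mulrC.
  - by rewrite oHZ nv !scalerA mulrC.
rewrite oKZ scalerA mulrC -scalerA => /(congr1 (fun x => (n - p.1)%:~R^-1 *: x)).
by rewrite !scalerA mulVf// mulrA mulVf// !mul1r scale1r.
Qed.

End JointWeights.

Definition weight_exp (n : int) : R[i] := (expR (h * n%:~R / 4))%:C.

Lemma weight_expD m n : weight_exp (m + n) = weight_exp m * weight_exp n.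
Proof.
by rewrite /weight_exp -rmorphM -expRD rmorphD mulrDr mulrDl.
Qed.

Lemma uact_joint (V : lmodType R[i]) (M : uqmodule V) v :
  joint_sum weight_exp (M uH) (M uK) v.
Proof.
have [s [sP vE]] := uact_diag M v; exists s; split=> // p ps.
by split; [exact: sP | apply: uact_K; exact: sP].
Qed.

Lemma uact_Ki (V : lmodType R[i]) (M : uqmodule V) n v :
  M uH v = n%:~R *: v -> M uKi v = weight_exp (- n) *: v.
Proof.
move=> /(uact_K (u := M)) Kv.
have e1 : weight_exp (- n) * weight_exp n = 1.
  by rewrite -weight_expD addNr /weight_exp mulr0 mul0r expR0.
rewrite -[v in LHS]scale1r -e1 -scalerA -Kv (linear_fZ (uact_linearr M _)).
by rewrite -uactM uq_KiK uact1.
Qed.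

Lemma joint_uq_diag (V : lmodType R[i]) (oH oK : V -> V) :
  (forall v, joint_sum weight_exp oH oK v) ->
  forall v, exists s : seq (int * V),
    (forall p, p \in s -> oH p.2 = p.1%:~R *: p.2) /\ v = \sum_(p <- s) p.2.
Proof.
by move=> J v; have [s [sP vE]] := J v; exists s; split=> // p /sP[].
Qed.

Section TensorModule.
Variables (V W : lmodType R[i]) (M : uqmodule V) (N : uqmodule W).

Definition tensor_act (x : Uq) (v : tensor V W) : tensor V W :=
  tact M N (coproduct x) v.

Let act_pure := tact_pure (uact_linearl M) (uact_linearr M)
  (uact_linearl N) (uact_linearr N).
Let actDl := tactDl (uact_linearl M) (uact_linearr M)
  (uact_linearl N) (uact_linearr N).
Let actDr := tactDr (uact_linearl M) (uact_linearr M)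
  (uact_linearl N) (uact_linearr N).
Let actZl := tactZl (uact_linearl M) (uact_linearr M)
  (uact_linearl N) (uact_linearr N).
Let actZr := tactZr (uact_linearl M) (uact_linearr M)
  (uact_linearl N) (uact_linearr N).

Lemma tensor_act_linearl v : linear (tensor_act^~ v).
Proof.
by move=> c x y; rewrite /tensor_act coproductD coproductZ actDl actZl.
Qed.

Lemma tensor_act_linearr x : linear (tensor_act x).
Proof. by move=> c u v; rewrite /tensor_act actDr actZr. Qed.

Lemma tensor_act1 v : tensor_act 1 v = v.
Proof.
rewrite /tensor_act coproduct1; elim/tensor_ind: v => [v w|c v IH|u v IH IH'].
- by rewrite act_pure !uact1.
- by rewrite actZr IH.
- by rewrite actDr IH IH'.
Qed.

Lemma tact_uactM x y v : tact M N (x * y) v = tact M N x (tact M N y v).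
Proof.
elim/tensor_ind: x => [a b|c x IH|x x' IH IH'].
- elim/tensor_ind: y => [a' b'|c y IH|y y' IH IH'].
  + elim/tensor_ind: v => [v w|c v IH|u v IH IH'].
    * by rewrite tensor_mulE !act_pure !uactM.
    * by rewrite !actZr IH.
    * by rewrite !actDr IH IH'.
  + by rewrite -tensor_scalerAr !actZl actZr IH.
  + by rewrite mulrDr !actDl actDr IH IH'.
- by rewrite -tensor_scalerAl !actZl IH.
- by rewrite mulrDl !actDl IH IH'.
Qed.

Lemma tensor_actM x y v : tensor_act (x * y) v = tensor_act x (tensor_act y v).
Proof. by rewrite /tensor_act coproductM tact_uactM. Qed.

Lemma tensor_act_H v w : tensor_act uH (v ⊗ w) = M uH v ⊗ w + v ⊗ N uH w.
Proof. by rewrite /tensor_act coproduct_H actDl !act_pure !uact1. Qed.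

Lemma tensor_act_Xp v w :
  tensor_act uXp (v ⊗ w) = M uXp v ⊗ N uK w + M uKi v ⊗ N uXp w.
Proof. by rewrite /tensor_act coproduct_Xp actDl !act_pure. Qed.

Lemma tensor_act_Xm v w :
  tensor_act uXm (v ⊗ w) = M uXm v ⊗ N uK w + M uKi v ⊗ N uXm w.
Proof. by rewrite /tensor_act coproduct_Xm actDl !act_pure. Qed.

Lemma tensor_act_K v w : tensor_act uK (v ⊗ w) = M uK v ⊗ N uK w.
Proof. by rewrite /tensor_act coproduct_K act_pure. Qed.

Lemma tensor_act_Ki v w : tensor_act uKi (v ⊗ w) = M uKi v ⊗ N uKi w.
Proof. by rewrite /tensor_act coproduct_Ki act_pure. Qed.

Lemma tensor_joint v : joint_sum weight_exp (tensor_act uH) (tensor_act uK) v.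
Proof.
have lH := tensor_act_linearr uH; have lK := tensor_act_linearr uK.
elim/tensor_ind: v => [v w|c v IH|u v IH IH']; last 2 first.
- exact: joint_sumZ.
- exact: joint_sumD.
have [Jv Jw] := (uact_joint M v, uact_joint N w).
elim/joint_sum_ind: v / Jv => [|u v|m v [vH vK]].
- by rewrite (linear_f0 (tpure_linearl w)); exact: joint_sum0.
- by rewrite tpureDl; exact: joint_sumD.
elim/joint_sum_ind: w / Jw => [|u w|n w [wH wK]].
- by rewrite (linear_f0 (tpure_linearr v)); exact: joint_sum0.
- by rewrite tpureDr; exact: joint_sumD.
apply: (@joint_sum_weight _ _ _ _ (m + n)); split.
- by rewrite tensor_act_H vH wH tpureZl tpureZr rmorphD scalerDl.
- by rewrite tensor_act_K vK wK tpureZl tpureZr scalerA weight_expD.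
Qed.

Definition tensor_module : uqmodule (tensor V W) :=
  UqModule tensor_act_linearl tensor_act_linearr tensor_act1 tensor_actM
    (joint_uq_diag tensor_joint)
    (fun n v => joint_sum_K (tensor_act_linearr uH) (tensor_act_linearr uK)
      (tensor_joint v)).

End TensorModule.

Section ModuleAlgebra.
Variable A : algType R[i].

Definition mult (y : tensor A A) : A := tlift ( *%R) y.

Record module_algebra (M : uqmodule A) : Prop := ModuleAlgebra {
  modalg1 : forall x, M x 1 = counit x *: 1;
  modalgM : forall x a b, M x (a * b) = mult (tensor_module M M x (a ⊗ b)) }.

Lemma mult_pure a b : mult (a ⊗ b) = a * b.
Proof. exact: tlift_pure (@mul_linearl _ _) (@mul_linearr _ _) _ _. Qed.

Lemma mult_linear : linear mult.
Proof. exact: tlift_linear (@mul_linearl _ _) (@mul_linearr _ _). Qed.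

Lemma module_algebra_gen (M : uqmodule A) :
  M uH 1 = 0 -> M uXp 1 = 0 -> M uXm 1 = 0 -> M uK 1 = 1 -> M uKi 1 = 1 ->
  (forall a b, M uH (a * b) = M uH a * b + a * M uH b) ->
  (forall a b, M uXp (a * b) = M uXp a * M uK b + M uKi a * M uXp b) ->
  (forall a b, M uXm (a * b) = M uXm a * M uK b + M uKi a * M uXm b) ->
  (forall a b, M uK (a * b) = M uK a * M uK b) ->
  (forall a b, M uKi (a * b) = M uKi a * M uKi b) ->
  module_algebra M.
Proof.
move=> H1 Xp1 Xm1 K1 Ki1 HM XpM XmM KM KiM; split.
  move=> x; elim/palg_ind: x => [[]||c x IH|x y IH IH'|x y IH IH'].
  - by rewrite counit_H scale0r.
  - by rewrite counit_Xp scale0r.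
  - by rewrite counit_Xm scale0r.
  - by rewrite counit_K scale1r.
  - by rewrite counit_Ki scale1r.
  - by rewrite uact1 counit1 scale1r.
  - by rewrite (linear_fZ (uact_linearl M _)) counitZ IH scalerA.
  - by rewrite (linear_fD (uact_linearl M _)) counitD IH IH' scalerDl.
  - rewrite uactM IH' (linear_fZ (uact_linearr M _)) IH counitM scalerA.
    by rewrite mulrC.
have ml := mult_linear; have Ml x := uact_linearr M x.
have Tl x := tensor_act_linearr M M x.
suff E x y : M x (mult y) = mult (tensor_act M M x y).
  by move=> x a b; rewrite -E mult_pure.
elim/palg_ind: x y => [g||c x IH|x x' IH IH'|x x' IH IH'] y.
- elim/tensor_ind: y => [a b|c y IH|y y' IH IH'].
  + rewrite mult_pure; case: g.
    * by rewrite HM tensor_act_H (linear_fD ml) !mult_pure.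
    * by rewrite XpM tensor_act_Xp (linear_fD ml) !mult_pure.
    * by rewrite XmM tensor_act_Xm (linear_fD ml) !mult_pure.
    * by rewrite KM tensor_act_K !mult_pure.
    * by rewrite KiM tensor_act_Ki !mult_pure.
  + by rewrite (linear_fZ ml) (linear_fZ (Ml _)) (linear_fZ (Tl _)) (linear_fZ ml) IH.
  + by rewrite (linear_fD ml) (linear_fD (Ml _)) (linear_fD (Tl _)) (linear_fD ml) IH IH'.
- by rewrite uact1 tensor_act1.
- rewrite (linear_fZ (uact_linearl M _)) (linear_fZ (tensor_act_linearl M M _)).
  by rewrite (linear_fZ ml) IH.
- rewrite (linear_fD (uact_linearl M _)) (linear_fD (tensor_act_linearl M M _)).
  by rewrite (linear_fD ml) IH IH'.
- by rewrite uactM tensor_actM IH' IH.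
Qed.

End ModuleAlgebra.

End QuantumSl2.

Section TwistedDerivation.
Variables (K : comNzRingType) (G : Type).
Variable rels : word K G -> word K G -> Prop.
Variables (A : algType K) (f g d : G -> A).

Local Notation ev := (weval (GRing.in_alg A)).

Fixpoint wderiv (w : word K G) : A :=
  match w with
  | Gen x => d x
  | Scal _ => 0
  | Add x y => wderiv x + wderiv y
  | Mul x y => ev f x * wderiv y + wderiv x * ev g y
  end.

(* The additive map D : palg rels -> A with D = d on generators and
   D (x * y) = f x * D y + D x * g y. *)
Definition pderiv (x : palg rels) : A := wderiv (repr x).

Lemma in_algC c (a : A) : GRing.comm (GRing.in_alg A c) a.
Proof. by rewrite /GRing.comm /= mulr_algl mulr_algr. Qed.

Hypothesis f_rel : forall x y, rels x y -> ev f x = ev f y.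
Hypothesis g_rel : forall x y, rels x y -> ev g x = ev g y.
Hypothesis d_rel : forall x y, rels x y -> wderiv x = wderiv y.

Let pf := plift (rels := rels) (GRing.in_alg A) f.
Let pg := plift (rels := rels) (GRing.in_alg A) g.

Lemma wderiv_wcong x y : wcong rels x y -> wderiv x = wderiv y.
Proof.
have fE := weval_wcong in_algC f_rel; have gE := weval_wcong in_algC g_rel.
elim=> {x y} //=.
- by move=> *; congruence.
- by move=> *; congruence.
- move=> x x' y y' xx' IHx yy' IHy.
  by rewrite IHx IHy (fE _ _ xx') (gE _ _ yy').
- by move=> *; rewrite addrA.
- by move=> *; rewrite addrC.
- by move=> *; rewrite add0r.
- by move=> *; rewrite mulrDr mulrDl !mulrA addrA.
- by move=> *; rewrite scale1r mul1r mul0r addr0.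
- by move=> *; rewrite !mulrDl addrACA.
- by move=> *; rewrite !mulrDr addrACA.
- by move=> *; rewrite scale0r !mul0r addr0.
- by move=> *; rewrite addr0.
- by move=> *; rewrite mulr0 mul0r addr0.
- by move=> *; rewrite mul0r mulr0 addr0 add0r mulr_algl mulr_algr.
Qed.

Lemma pderivE w : pderiv (pclass w) = wderiv w.
Proof. by apply: wderiv_wcong; exact: repr_pclass. Qed.

Lemma pderiv_gen x : pderiv (pgen x) = d x.
Proof. exact: pderivE. Qed.

Lemma pderiv1 : pderiv 1 = 0.
Proof. exact: pderivE. Qed.

Lemma pderivM x y : pderiv (x * y) = pf x * pderiv y + pderiv x * pg y.
Proof.
elim/palgP: x => x; elim/palgP: y => y; rewrite -pclassM !pderivE.
by rewrite /pf /pg !pliftE //; exact: in_algC.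
Qed.

Lemma pderiv_linear : linear pderiv.
Proof.
move=> c; elim/palgP=> x; elim/palgP=> y.
rewrite -[c *: _]/(pscale _ _) pscaleE -pclassD !pderivE /=.
by rewrite mul0r addr0 mulr_algl.
Qed.

End TwistedDerivation.

(* Pol(Y)_q is the coordinate algebra of quantum SL_2 for Y = Xtilde and of
   the quantum cone det_q = 0 for Y = Xitilde. *)
Variant quadric := Xtilde | Xitilde.

Definition delta (K : pzRingType) (Y : quadric) : K :=
  match Y with Xtilde => 1 | Xitilde => 0 end.

Variant idx := i1 | i2.

Section Pol.
Variables (R : realType) (q : R) (Y : quadric).

Local Notation t i j := (Gen (i, j)).

Inductive pol_rel : word R[i] (idx * idx) -> word R[i] (idx * idx) -> Prop :=
| Pol1112 : pol_rel (t i1 i1 * t i1 i2) (q%:C *: (t i1 i2 * t i1 i1))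
| Pol2122 : pol_rel (t i2 i1 * t i2 i2) (q%:C *: (t i2 i2 * t i2 i1))
| Pol1121 : pol_rel (t i1 i1 * t i2 i1) (q%:C *: (t i2 i1 * t i1 i1))
| Pol1222 : pol_rel (t i1 i2 * t i2 i2) (q%:C *: (t i2 i2 * t i1 i2))
| Pol1221 : pol_rel (t i1 i2 * t i2 i1) (t i2 i1 * t i1 i2)
| Pol1122 : pol_rel (t i1 i1 * t i2 i2 - t i2 i2 * t i1 i1)
    ((q%:C - q%:C^-1) *: (t i1 i2 * t i2 i1))
| PolDet : pol_rel (t i1 i1 * t i2 i2 - q%:C *: (t i1 i2 * t i2 i1))
    (Scal (delta _ Y)).

Definition Pol : Type := palg pol_rel.
HB.instance Definition _ := Choice.on Pol.
HB.instance Definition _ := GRing.PzRing.on Pol.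
HB.instance Definition _ := GRing.Lmodule.on Pol.

Let chi_gen (g : idx * idx) : R[i] :=
  match g with (i1, i1) | (i2, i2) => delta _ Y | _ => 0 end.

Let chi_rel x y : pol_rel x y -> weval idfun chi_gen x = weval idfun chi_gen y.
Proof.
by case=> /=; case: Y; rewrite /= ?(mulr0, mul0r, mulr1, addr0, subrr, oppr0).
Qed.

Let idC (c x : R[i]) : GRing.comm (idfun c) x.
Proof. exact: mulrC. Qed.

Lemma Pol_neq0 : (1 : Pol) != 0.
Proof.
apply/eqP => /(congr1 (plift idfun chi_gen)).
rewrite plift1// -[0](scale0r (1 : Pol)) pliftZ//= mul0r.
by apply/eqP; exact: oner_neq0.
Qed.

HB.instance Definition _ := GRing.PzSemiRing_isNonZero.Build Pol Pol_neq0.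
HB.instance Definition _ :=
  GRing.Lmodule_isLalgebra.Build R[i] Pol (@pscaleAl _ _ _).
HB.instance Definition _ :=
  GRing.Lalgebra_isAlgebra.Build R[i] Pol (@pscaleAr _ _ _).

Definition pol_t (i j : idx) : Pol := pgen (i, j).

End Pol.

Arguments pol_t {R q Y}.

Section PolAction.
Variables (R : realType) (q : R) (Y : quadric).
Local Notation Pol := (Pol q Y).
Local Notation t i j := (pol_t i j : Pol).

Let classN (x y : word R[i] (idx * idx)) :
  pclass (x - y)%W = (pclass x : Pol) - pclass y.
Proof. by rewrite pclassD pclassM pclassS scaleN1r mulN1r. Qed.

Let classZ c (x : word R[i] (idx * idx)) : pclass (c *: x)%W = c *: (pclass x : Pol).
Proof. by rewrite pclassM pclassS -pscaleAl mul1r. Qed.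

Lemma pol_1112 : t i1 i1 * t i1 i2 = q%:C *: (t i1 i2 * t i1 i1).
Proof. by have := prel_eq (Pol1112 q Y); rewrite classZ !pclassM. Qed.
Lemma pol_2122 : t i2 i1 * t i2 i2 = q%:C *: (t i2 i2 * t i2 i1).
Proof. by have := prel_eq (Pol2122 q Y); rewrite classZ !pclassM. Qed.
Lemma pol_1121 : t i1 i1 * t i2 i1 = q%:C *: (t i2 i1 * t i1 i1).
Proof. by have := prel_eq (Pol1121 q Y); rewrite classZ !pclassM. Qed.
Lemma pol_1222 : t i1 i2 * t i2 i2 = q%:C *: (t i2 i2 * t i1 i2).
Proof. by have := prel_eq (Pol1222 q Y); rewrite classZ !pclassM. Qed.
Lemma pol_1221 : t i1 i2 * t i2 i1 = t i2 i1 * t i1 i2.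
Proof. by have := prel_eq (Pol1221 q Y); rewrite !pclassM. Qed.
Lemma pol_1122 : t i1 i1 * t i2 i2 - t i2 i2 * t i1 i1 =
  (q%:C - q%:C^-1) *: (t i1 i2 * t i2 i1).
Proof. by have := prel_eq (Pol1122 q Y); rewrite classN classZ !pclassM. Qed.
Lemma pol_det : t i1 i1 * t i2 i2 - q%:C *: (t i1 i2 * t i2 i1) =
  (delta _ Y)%:A.
Proof.
by have := prel_eq (PolDet q Y); rewrite classN classZ !pclassM pclassS.
Qed.

Local Notation ev := (weval (GRing.in_alg Pol)).
Local Notation tC := (@in_algC _ Pol).

Definition pol_gen (g : idx * idx) : Pol := pgen g.

Let ev_pgen w : ev pol_gen w = pclass w.
Proof.
elim: w => [g|c|x IHx y IHy|x IHx y IHy] //=.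
- by rewrite pclassS.
- by rewrite pclassD IHx IHy.
- by rewrite pclassM IHx IHy.
Qed.

Let pgen_rel x y : pol_rel q Y x y ->
  ev pol_gen x = ev pol_gen y.
Proof. by rewrite !ev_pgen; exact: prel_eq. Qed.

Let plift_pgen (x : Pol) :
  plift (GRing.in_alg Pol) pol_gen x = x.
Proof. by elim/palgP: x => x; rewrite pliftE// ?ev_pgen//; exact: tC. Qed.

Definition pol_scale_gen (s : R[i]) (g : idx * idx) : Pol :=
  (match g.2 with i1 => s | i2 => s^-1 end) *: pgen g.

Let simp := (mulr_algl, mulr_algr, mulN1r, scaleN1r, mul0r, mulr0, add0r,
  addr0, mulrN, mulNr, scalerN, oppr0, scaler0, subr0, subrr).

Let scale_rel s x y : s != 0 -> pol_rel q Y x y ->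
  ev (pol_scale_gen s) x = ev (pol_scale_gen s) y.
Proof.
move=> s0; case=> /=; rewrite /pol_scale_gen /= ?simp -?scalerAl -?scalerAr;
  rewrite ?scalerA ?(mulrC s^-1 s) ?mulfV // ?divfK // ?scale1r.
- exact: pol_1112.
- exact: pol_2122.
- by rewrite pol_1121 scalerA mulrC mulrA.
- by rewrite pol_1222 scalerA mulrC mulrA.
- exact: pol_1221.
- exact: pol_1122.
- exact: pol_det.
Qed.

Definition pol_dH (g : idx * idx) : Pol := match g.2 with i1 => pgen g | i2 => - pgen g end.
Definition pol_dXp (g : idx * idx) : Pol := match g.2 with i1 => 0 | i2 => t g.1 i1 end.
Definition pol_dXm (g : idx * idx) : Pol := match g.2 with i1 => t g.1 i2 | i2 => 0 end.

Let dH_rel x y : pol_rel q Y x y ->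
  wderiv pol_gen pol_gen pol_dH x = wderiv pol_gen pol_gen pol_dH y.
Proof.
case=> /=; rewrite /pol_dH /= ?simp ?addNr ?addrN ?simp //.
- by rewrite -![X in X + _]/(pol_t _ _ * pol_t _ _) pol_1121 scalerDr.
- rewrite -opprD -[X in - X]/(pol_t _ _ * pol_t _ _ + pol_t _ _ * pol_t _ _).
  by rewrite pol_1222 -scalerDr -scalerN opprD.
Qed.

Let pol_1122E :
  t i1 i1 * t i2 i2 = t i2 i2 * t i1 i1 + (q%:C - q%:C^-1) *: (t i1 i2 * t i2 i1).
Proof. by rewrite -pol_1122 addrC subrK. Qed.

Section Deformed.
Variable s : R[i].
Hypothesis s0 : s != 0.
Hypothesis qE : q%:C = s^-1 * s^-1.

Let qVE : q%:C^-1 = s * s.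
Proof. by rewrite qE invfM invrK. Qed.

Let qs : q%:C * s = s^-1.
Proof. by rewrite qE -mulrA mulVf// mulr1. Qed.

Let dXp_rel x y : pol_rel q Y x y ->
  wderiv (pol_scale_gen s^-1) (pol_scale_gen s) pol_dXp x =
  wderiv (pol_scale_gen s^-1) (pol_scale_gen s) pol_dXp y.
Proof.
case=> /=; rewrite /pol_dXp /pol_scale_gen /= ?simp ?invrK -?scalerAl -?scalerAr ?scalerA -?/(pol_t _ _).
- by rewrite qs.
- by rewrite qs.
- by [].
- rewrite pol_1122E -pol_1221 !scalerDr !scalerA addrCA -scalerDl qs.
  by congr (_ + _ *: _); rewrite mulrBr qVE mulrA mulVf// mul1r mulrC addrC subrK.
- by rewrite pol_1121 scalerA [s * _]mulrC qs.
- have -> : t i2 i1 * t i1 i1 = q%:C^-1 *: (t i1 i1 * t i2 i1).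
    rewrite pol_1121 scalerA mulVf ?scale1r// qE.
    by rewrite mulf_neq0// invr_eq0.
  rewrite scalerA -scalerBl mulrBl qs; congr ((_ - _) *: _).
  by rewrite mulrC.
- by rewrite qs subrr.
Qed.

Let dXm_rel x y : pol_rel q Y x y ->
  wderiv (pol_scale_gen s^-1) (pol_scale_gen s) pol_dXm x =
  wderiv (pol_scale_gen s^-1) (pol_scale_gen s) pol_dXm y.
Proof.
case=> /=; rewrite /pol_dXm /pol_scale_gen /= ?simp ?invrK -?scalerAl -?scalerAr ?scalerA -?/(pol_t _ _).
- by rewrite qs.
- by rewrite qs.
- rewrite pol_1122E -pol_1221 !scalerDr !scalerA qs -addrA -scalerDl addrC.
  by congr (_ *: _ + _); rewrite mulrBr qVE mulrA mulVf// mul1r subrK mulrC.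
- by [].
- by rewrite pol_1222 scalerA [s * _]mulrC qs.
- have -> : t i2 i2 * t i1 i2 = q%:C^-1 *: (t i1 i2 * t i2 i2).
    rewrite pol_1222 scalerA mulVf ?scale1r// qE.
    by rewrite mulf_neq0// invr_eq0.
  rewrite scalerA -scalerBl mulrBl qs; congr ((_ - _) *: _).
  by rewrite mulrC.
- by rewrite qs subrr.
Qed.

Definition pol_H : Pol -> Pol := pderiv pol_gen pol_gen pol_dH.
Definition pol_Xp : Pol -> Pol :=
  pderiv (pol_scale_gen s^-1) (pol_scale_gen s) pol_dXp.
Definition pol_Xm : Pol -> Pol :=
  pderiv (pol_scale_gen s^-1) (pol_scale_gen s) pol_dXm.
Definition pol_K : Pol -> Pol := plift (GRing.in_alg Pol) (pol_scale_gen s).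
Definition pol_Ki : Pol -> Pol := plift (GRing.in_alg Pol) (pol_scale_gen s^-1).

Let sV0 : s^-1 != 0. Proof. by rewrite invr_eq0. Qed.
Let rK := fun x y => @scale_rel s x y s0.
Let rKi := fun x y => @scale_rel s^-1 x y sV0.

Lemma pol_H_linear : linear pol_H.
Proof. exact: pderiv_linear pgen_rel pgen_rel dH_rel. Qed.
Lemma pol_Xp_linear : linear pol_Xp.
Proof. exact: pderiv_linear rKi rK dXp_rel. Qed.
Lemma pol_Xm_linear : linear pol_Xm.
Proof. exact: pderiv_linear rKi rK dXm_rel. Qed.
Lemma pol_K_linear : linear pol_K.
Proof.
by move=> c x y; rewrite /pol_K (pliftD tC rK) (pliftZ tC rK) /= mulr_algl.
Qed.
Lemma pol_Ki_linear : linear pol_Ki.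
Proof.
by move=> c x y; rewrite /pol_Ki (pliftD tC rKi) (pliftZ tC rKi) /= mulr_algl.
Qed.

Lemma pol_HM x y : pol_H (x * y) = pol_H x * y + x * pol_H y.
Proof.
by rewrite /pol_H (pderivM pgen_rel pgen_rel dH_rel) !plift_pgen addrC.
Qed.
Lemma pol_XpM x y : pol_Xp (x * y) = pol_Xp x * pol_K y + pol_Ki x * pol_Xp y.
Proof. by rewrite /pol_Xp (pderivM rKi rK dXp_rel) addrC. Qed.
Lemma pol_XmM x y : pol_Xm (x * y) = pol_Xm x * pol_K y + pol_Ki x * pol_Xm y.
Proof. by rewrite /pol_Xm (pderivM rKi rK dXm_rel) addrC. Qed.
Lemma pol_KM x y : pol_K (x * y) = pol_K x * pol_K y.
Proof. exact: pliftM tC rK _ _. Qed.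
Lemma pol_KiM x y : pol_Ki (x * y) = pol_Ki x * pol_Ki y.
Proof. exact: pliftM tC rKi _ _. Qed.

Lemma pol_H1 : pol_H 1 = 0.
Proof. exact: pderiv1 pgen_rel pgen_rel dH_rel. Qed.
Lemma pol_Xp1 : pol_Xp 1 = 0.
Proof. exact: pderiv1 rKi rK dXp_rel. Qed.
Lemma pol_Xm1 : pol_Xm 1 = 0.
Proof. exact: pderiv1 rKi rK dXm_rel. Qed.
Lemma pol_K1 : pol_K 1 = 1.
Proof. exact: plift1 tC rK. Qed.
Lemma pol_Ki1 : pol_Ki 1 = 1.
Proof. exact: plift1 tC rKi. Qed.

Lemma pol_H_gen g : pol_H (pgen g) = pol_dH g.
Proof. exact: pderiv_gen pgen_rel pgen_rel dH_rel _. Qed.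
Lemma pol_Xp_gen g : pol_Xp (pgen g) = pol_dXp g.
Proof. exact: pderiv_gen rKi rK dXp_rel _. Qed.
Lemma pol_Xm_gen g : pol_Xm (pgen g) = pol_dXm g.
Proof. exact: pderiv_gen rKi rK dXm_rel _. Qed.
Lemma pol_K_gen g : pol_K (pgen g) = pol_scale_gen s g.
Proof. exact: plift_gen tC rK _. Qed.
Lemma pol_Ki_gen g : pol_Ki (pgen g) = pol_scale_gen s^-1 g.
Proof. exact: plift_gen tC rKi _. Qed.

End Deformed.
End PolAction.

Section PolOperators.
Variables (R : realType) (q : R) (Y : quadric) (s : R[i]).
Hypothesis s0 : s != 0.
Hypothesis qE : q%:C = s^-1 * s^-1.
Hypothesis den0 : s * s - s^-1 * s^-1 != 0.
Local Notation Pol := (Pol q Y).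

Local Notation H := (@pol_H R q Y).
Local Notation Xp := (@pol_Xp R q Y s).
Local Notation Xm := (@pol_Xm R q Y s).
Local Notation Kp := (@pol_K R q Y s).
Local Notation Km := (@pol_Ki R q Y s).

Let lH : linear H := @pol_H_linear R q Y.
Let lXp : linear Xp := @pol_Xp_linear R q Y s s0 qE.
Let lXm : linear Xm := @pol_Xm_linear R q Y s s0 qE.
Let lK : linear Kp := @pol_K_linear R q Y s s0.
Let lKi : linear Km := @pol_Ki_linear R q Y s s0.

Let genE := (@pol_H_gen R q Y, @pol_Xp_gen R q Y s s0 qE,
  @pol_Xm_gen R q Y s s0 qE, @pol_K_gen R q Y s s0,
  @pol_Ki_gen R q Y s s0).
Let oneE := (@pol_H1 R q Y, @pol_Xp1 R q Y s s0 qE,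
  @pol_Xm1 R q Y s s0 qE, @pol_K1 R q Y s s0,
  @pol_Ki1 R q Y s s0).
Let mulE := (@pol_HM R q Y, @pol_XpM R q Y s s0 qE,
  @pol_XmM R q Y s s0 qE, @pol_KM R q Y s s0,
  @pol_KiM R q Y s s0).
Let addE := (linear_fD lH, linear_fD lXp, linear_fD lXm, linear_fD lK,
  linear_fD lKi).
Let scaleE := (linear_fZ lH, linear_fZ lXp, linear_fZ lXm, linear_fZ lK,
  linear_fZ lKi).
Let zeroE := (linear_f0 lH, linear_f0 lXp, linear_f0 lXm, linear_f0 lK,
  linear_f0 lKi).

Let KKi x : Kp (Km x) = x.
Proof.
elim/palg_ind: x => [[i []]||c x IH|x y IH IH'|x y IH IH'].
- by rewrite !genE /= !(scaleE, genE) /= scalerA mulVf// scale1r.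
- by rewrite !genE /= !(scaleE, genE) /= scalerA mulVf ?invr_eq0// scale1r.
- by rewrite !oneE.
- by rewrite !scaleE IH.
- by rewrite !addE IH IH'.
- by rewrite !mulE IH IH'.
Qed.

Let KiK x : Km (Kp x) = x.
Proof.
elim/palg_ind: x => [[i []]||c x IH|x y IH IH'|x y IH IH'].
- by rewrite !genE /= !(scaleE, genE) /= scalerA mulfV// scale1r.
- by rewrite !genE /= !(scaleE, genE) /= scalerA mulfV ?invr_eq0// scale1r.
- by rewrite !oneE.
- by rewrite !scaleE IH.
- by rewrite !addE IH IH'.
- by rewrite !mulE IH IH'.
Qed.

Let HK x : H (Kp x) = Kp (H x).
Proof.
elim/palg_ind: x => [[i []]||c x IH|x y IH IH'|x y IH IH'].
- by rewrite !genE /= !(scaleE, genE).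
- rewrite !genE /= !(scaleE, genE) /=. 
  by rewrite /pol_dH /pol_scale_gen /= scalerN scaleN1r.
- by rewrite !(oneE, zeroE).
- by rewrite !scaleE IH.
- by rewrite !addE IH IH'.
- by rewrite !(mulE, addE) IH IH'.
Qed.

Let HKi x : H (Km x) = Km (H x).
Proof. by rewrite -[in RHS](KKi x) HK KiK. Qed.

Let KXp x : Kp (Xp x) = (s * s) *: Xp (Kp x).
Proof.
elim/palg_ind: x => [[i []]||c x IH|x y IH IH'|x y IH IH'].
- by rewrite !genE /= !(scaleE, genE, zeroE) /= !scaler0.
- rewrite !genE /= !(scaleE, genE) /= scalerA.
  by rewrite -mulrA mulfV// mulr1.
- by rewrite !(oneE, zeroE) scaler0.
- by rewrite !scaleE IH !scalerA mulrC.
- by rewrite !addE IH IH' scalerDr.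
- by rewrite !(mulE, addE) IH IH' KKi KiK scalerDr scalerAl scalerAr.
Qed.

Let KXm x : Kp (Xm x) = (s^-1 * s^-1) *: Xm (Kp x).
Proof.
elim/palg_ind: x => [[i []]||c x IH|x y IH IH'|x y IH IH'].
- rewrite !genE /= !(scaleE, genE) /= scalerA.
  by rewrite -mulrA mulVf// mulr1.
- by rewrite !genE /= !(scaleE, genE, zeroE) /= !scaler0.
- by rewrite !(oneE, zeroE) scaler0.
- by rewrite !scaleE IH !scalerA mulrC.
- by rewrite !addE IH IH' scalerDr.
- by rewrite !(mulE, addE) IH IH' KKi KiK scalerDr scalerAl scalerAr.
Qed.

Let KiXp x : Km (Xp x) = (s^-1 * s^-1) *: Xp (Km x).
Proof.
rewrite -[Xp (Km x)]KiK KXp KKi scaleE scalerA.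
by rewrite mulrACA mulVf// mulr1 scale1r.
Qed.

Let KiXm x : Km (Xm x) = (s * s) *: Xm (Km x).
Proof.
rewrite -[Xm (Km x)]KiK KXm KKi scaleE scalerA.
by rewrite mulrACA mulfV// mulr1 scale1r.
Qed.

Let HXp x : H (Xp x) = Xp (H x) + 2 *: Xp x.
Proof.
elim/palg_ind: x => [[i []]||c x IH|x y IH IH'|x y IH IH'].
- by rewrite !genE /= !(genE, zeroE) /= scaler0 addr0.
- rewrite !genE /= (linear_fN lXp) !genE /= /pol_dH /= scaler_nat mulr2n.
  by rewrite addrA addNr add0r.
- by rewrite !(oneE, zeroE) scaler0 addr0.
- by rewrite !scaleE IH scalerDr !scalerA mulrC.
- by rewrite !addE IH IH' scalerDr addrACA.
- rewrite !(mulE, addE) IH IH' HK HKi.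
rewrite !mulrDl !mulrDr -!scalerAl -!scalerAr !scalerDr !addrA.
  by rewrite [LHS](ACl (1*4*3*5*2*6)).
Qed.

Let HXm x : H (Xm x) = Xm (H x) - 2 *: Xm x.
Proof.
elim/palg_ind: x => [[i []]||c x IH|x y IH IH'|x y IH IH'].
- rewrite !genE /=.
  rewrite /pol_dH /= scaler_nat mulr2n.
  by rewrite opprD addrA subrr add0r.
- by rewrite !genE /= !(scaleE, genE, zeroE) /= !scaler0 subr0.
- by rewrite !(oneE, zeroE) scaler0 subr0.
- by rewrite !scaleE IH scalerBr !scalerA mulrC.
- by rewrite !addE IH IH' scalerDr opprD addrACA.
- rewrite !(mulE, addE) IH IH' HK HKi.
  rewrite !mulrDl !mulrDr !mulNr !mulrN -!scalerAl -!scalerAr !scalerDr opprD !addrA.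
  by rewrite [LHS](ACl (1*4*3*5*2*6)).
Qed.

Let XpXm x : Xp (Xm x) - Xm (Xp x) =
  (s * s - s^-1 * s^-1)^-1 *: (Kp (Kp x) - Km (Km x)).
Proof.
elim/palg_ind: x => [[i []]||c x IH|x y IH IH'|x y IH IH'].
- rewrite !genE /= !(genE, zeroE, scaleE) /pol_scale_gen /pol_dXp /=.
  by rewrite subr0 !scalerA -scalerBl scalerA mulVf// scale1r.
- rewrite !genE /= !(genE, zeroE, scaleE) /pol_scale_gen /pol_dXm /=.
  rewrite !invrK sub0r !scalerA -scalerBl scalerA.
  by rewrite -[X in _ * X]opprB mulrN mulVf// scaleN1r.
- by rewrite !(oneE, zeroE) !subrr scaler0.
- by rewrite !scaleE -!scalerBr IH !scalerA mulrC.
- by rewrite !addE opprD addrACA IH IH' -scalerDr opprD addrACA.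
rewrite !(mulE, addE) KiXm KiXp KXp KXm.
  rewrite -!scalerAl -!scalerAr.
have cancel (a b c d a' d' : Pol) :
      a + b + (c + d) - (a' + c + (b + d')) = a - a' + (d - d').
    have -> : a + b + (c + d) = a + d + (b + c).
      by rewrite !addrA [LHS](ACl (1*4*2*3)).
    have -> : a' + c + (b + d') = a' + d' + (b + c).
      by rewrite !addrA [LHS](ACl (1*4*3*2)).
    by rewrite opprD addrACA subrr addr0 opprD addrACA.
  rewrite {}cancel -mulrBl -mulrBr IH IH' -scalerAl -scalerAr -scalerDr.
  by rewrite mulrBl mulrBr addrA subrK.
Qed.

Definition pol_op (g : uqgen) : linop Pol :=
  match g with
  | UH => LinOp lH
  | UXp => LinOp lXp
  | UXm => LinOp lXm
  | UK => LinOp lK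
  | UKi => LinOp lKi
  end.

Lemma pol_op_rel h x y : (expR (h / 2))%:C = s * s ->
  (expR (- (h / 2)))%:C = s^-1 * s^-1 -> uq_rel h x y ->
  weval (@linop_scalar _ Pol) pol_op x = weval (@linop_scalar _ Pol) pol_op y.
Proof.
move=> s2 sV2; case; apply: linopP => v /=.
- by rewrite scaleN1r HXp addrC addKr.
- by rewrite scaleN1r HXm addrC addKr scaleNr.
- by rewrite !scaleN1r XpXm -s2 -sV2 -rmorphB.
- by rewrite KKi scale1r.
- by rewrite KiK scale1r.
- by rewrite HK.
- by rewrite KXp s2.
- by rewrite KXm sV2.
Qed.

End PolOperators.

Section PolModule.
Variables (R : realType) (q h : R) (Y : quadric).
Hypothesis h0 : 0 < h.
Hypothesis qh : q = expR (- (h / 2)).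
Local Notation Pol := (Pol q Y).

Local Notation s := (expR (h / 4))%:C.

Let s0 : s != 0 :> R[i].
Proof.
by rewrite fmorph_eq0 gt_eqF// expR_gt0.
Qed.

Let sVE : s^-1 = (expR (- (h / 4)))%:C :> R[i].
Proof.
by rewrite -[RHS](mulKf s0) expR_realC mulr1.
Qed.

Let half : h / 2 = h / 4 + h / 4.
Proof. by field. Qed.

Let s2 : (expR (h / 2))%:C = s * s :> R[i].
Proof. by rewrite half expRD rmorphM. Qed.

Let sV2 : (expR (- (h / 2)))%:C = s^-1 * s^-1 :> R[i].
Proof. by rewrite half opprD expRD rmorphM sVE. Qed.

Let qE : q%:C = s^-1 * s^-1 :> R[i].
Proof. by rewrite qh sV2. Qed.

Let denE : (expR (h / 2) - expR (- (h / 2)))%:C = s * s - s^-1 * s^-1 :> R[i].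
Proof. by rewrite -s2 -sV2 -rmorphB. Qed.

Let den0 : s * s - s^-1 * s^-1 != 0 :> R[i].
Proof.
rewrite -denE fmorph_eq0 subr_eq0; apply/eqP => /expR_inj e.
by have := h0; lra.
Qed.

Let op : uqgen -> linop Pol := pol_op Y s0 qE.

Let op_rel x y : uq_rel h x y ->
  weval (@linop_scalar _ Pol) op x = weval (@linop_scalar _ Pol) op y.
Proof. exact: pol_op_rel. Qed.

Let opC (c : R[i]) (f : linop Pol) : GRing.comm (linop_scalar Pol c) f.
Proof. exact: linop_scalarC. Qed.

Definition pol_act (x : Uq h) (v : Pol) : Pol :=
  plift (@linop_scalar _ Pol) op x v.

Lemma pol_act_linearl v : linear (pol_act^~ v).
Proof.
by move=> c x y; rewrite /pol_act (pliftD opC op_rel) (pliftZ opC op_rel).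
Qed.

Lemma pol_act_linearr x : linear (pol_act x).
Proof. exact: linop_linear. Qed.

Lemma pol_act1 v : pol_act 1 v = v.
Proof. by rewrite /pol_act (plift1 opC op_rel). Qed.

Lemma pol_actM x y v : pol_act (x * y) v = pol_act x (pol_act y v).
Proof. by rewrite /pol_act (pliftM opC op_rel). Qed.

Let act_gen g v : pol_act (pgen g) v = op g v.
Proof. by rewrite /pol_act (plift_gen opC op_rel). Qed.

Let act_H v : pol_act (uH h) v = op UH v. Proof. exact: act_gen. Qed.
Let act_K v : pol_act (uK h) v = op UK v. Proof. exact: act_gen. Qed.

Lemma pol_joint v :
  joint_sum (weight_exp h) (pol_act (uH h)) (pol_act (uK h)) v.
Proof.
have lH := pol_act_linearr (uH h); have lK := pol_act_linearr (uK h).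
elim/palg_ind: v => [[i j]||c x IH|x y IH IH'|x y IH IH'].
- case: j.
  + apply: (@joint_sum_weight _ _ _ _ _ 1); split.
      by rewrite act_H /= pol_H_gen scale1r.
    by rewrite act_K /= pol_K_gen// /weight_exp mulr1.
  + apply: (@joint_sum_weight _ _ _ _ _ (-1)); split.
      by rewrite act_H /= pol_H_gen scaleN1r.
    by rewrite act_K /= pol_K_gen// /weight_exp mulrN1 mulNr -sVE.
- apply: (@joint_sum_weight _ _ _ _ _ 0); split.
    by rewrite act_H /= pol_H1 scale0r.
  by rewrite act_K /= pol_K1// /weight_exp mulr0 mul0r expR0 scale1r.
- exact: joint_sumZ.
- exact: joint_sumD.
elim/joint_sum_ind: x / IH => [|u v IHu IHv|m x [xH xK]].
- by rewrite mul0r; exact: joint_sum0.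
- by rewrite mulrDl; exact: joint_sumD.
elim/joint_sum_ind: y / IH' => [|u v IHu IHv|n y [yH yK]].
- by rewrite mulr0; exact: joint_sum0.
- by rewrite mulrDr; exact: joint_sumD.
apply: (@joint_sum_weight _ _ _ _ _ (m + n)); split.
- move: xH yH; rewrite !act_H /= pol_HM => -> ->.
  by rewrite -scalerAl -scalerAr -scalerDl rmorphD.
- move: xK yK; rewrite !act_K /= pol_KM// => -> ->.
  by rewrite -scalerAl -scalerAr scalerA weight_expD.
Qed.

(* Lemmas pol_module_algebra, pol_module_H1 to pol_module_Xm2 and
   pol_module_unique below: this is the only module algebra structure with the
   prescribed action on the generators. *)
Definition pol_module : uqmodule h Pol :=
  UqModule pol_act_linearl pol_act_linearr pol_act1 pol_actM
    (joint_uq_diag pol_joint)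
    (fun n v => joint_sum_K (pol_act_linearr (uH h)) (pol_act_linearr (uK h))
      (pol_joint v)).

Local Notation t i j := (pol_t i j : Pol).

Lemma pol_module_H1 i : pol_module (uH h) (t i i1) = t i i1.
Proof. by rewrite [LHS]act_gen /= [LHS]pol_H_gen. Qed.
Lemma pol_module_H2 i : pol_module (uH h) (t i i2) = - t i i2.
Proof. by rewrite [LHS]act_gen /= [LHS]pol_H_gen. Qed.
Lemma pol_module_Xp1 i : pol_module (uXp h) (t i i1) = 0.
Proof. by rewrite [LHS]act_gen /= [LHS](pol_Xp_gen Y s0 qE). Qed.
Lemma pol_module_Xp2 i : pol_module (uXp h) (t i i2) = t i i1.
Proof. by rewrite [LHS]act_gen /= [LHS](pol_Xp_gen Y s0 qE). Qed.
Lemma pol_module_Xm1 i : pol_module (uXm h) (t i i1) = t i i2.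
Proof. by rewrite [LHS]act_gen /= [LHS](pol_Xm_gen Y s0 qE). Qed.
Lemma pol_module_Xm2 i : pol_module (uXm h) (t i i2) = 0.
Proof. by rewrite [LHS]act_gen /= [LHS](pol_Xm_gen Y s0 qE). Qed.

Let modE g v : pol_module (pgen g) v = op g v. Proof. exact: act_gen. Qed.
Let modH v : pol_module (uH h) v = op UH v. Proof. exact: act_gen. Qed.
Let modXp v : pol_module (uXp h) v = op UXp v. Proof. exact: act_gen. Qed.
Let modXm v : pol_module (uXm h) v = op UXm v. Proof. exact: act_gen. Qed.
Let modK v : pol_module (uK h) v = op UK v. Proof. exact: act_gen. Qed.
Let modKi v : pol_module (uKi h) v = op UKi v. Proof. exact: act_gen. Qed.

Lemma pol_module_algebra : module_algebra pol_module.
Proof.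
apply: module_algebra_gen => [|||||a b|a b|a b|a b|a b];
  rewrite ?modH ?modXp ?modXm ?modK ?modKi /=.
- exact: pol_H1.
- exact: pol_Xp1.
- exact: pol_Xm1.
- exact: pol_K1.
- exact: pol_Ki1.
- exact: pol_HM.
- exact: pol_XpM.
- exact: pol_XmM.
- exact: pol_KM.
- exact: pol_KiM.
Qed.

Lemma pol_module_unique (M : uqmodule h Pol) : module_algebra M ->
  (forall i, [/\ M (uH h) (t i i1) = t i i1, M (uXp h) (t i i1) = 0 &
                 M (uXm h) (t i i1) = t i i2]) ->
  (forall i, [/\ M (uH h) (t i i2) = - t i i2, M (uXp h) (t i i2) = t i i1 &
                 M (uXm h) (t i i2) = 0]) ->
  forall x v, M x v = pol_module x v.
Proof.
move=> [M1 MM] T1 T2 x.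
have PM1 := modalg1 pol_module_algebra; have PMM := modalgM pol_module_algebra.
elim/palg_ind: x => [g||c x IH|x y IH IH'|x y IH IH'] v; last 4 first.
- by rewrite !uact1.
- by rewrite !(linear_fZ (uact_linearl _ _)) IH.
- by rewrite !(linear_fD (uact_linearl _ _)) IH IH'.
- by rewrite !uactM IH' IH.
elim/palg_ind: v g => [[i j]||c a IH|a b IH IH'|a b IH IH'] g.
- have [[H1 Xp1 Xm1] [H2 Xp2 Xm2]] := (T1 i, T2 i).
  have wE n v : M (uH h) v = n%:~R *: v -> pol_module (uH h) v = n%:~R *: v ->
      (M (uK h) v = pol_module (uK h) v) * (M (uKi h) v = pol_module (uKi h) v).
    by move=> a b; rewrite (uact_K a) (uact_K b) (uact_Ki a) (uact_Ki b).
  case: j.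
  + have [wK wKi] : (M (uK h) (t i i1) = pol_module (uK h) (t i i1)) *
        (M (uKi h) (t i i1) = pol_module (uKi h) (t i i1)).
      by apply: (wE 1); rewrite ?H1 ?pol_module_H1 scale1r.
    case: g => //.
    * by rewrite [LHS]H1 [RHS]pol_module_H1.
    * by rewrite [LHS]Xp1 [RHS]pol_module_Xp1.
    * by rewrite [LHS]Xm1 [RHS]pol_module_Xm1.
  + have [wK wKi] : (M (uK h) (t i i2) = pol_module (uK h) (t i i2)) *
        (M (uKi h) (t i i2) = pol_module (uKi h) (t i i2)).
      by apply: (wE (-1)); rewrite ?H2 ?pol_module_H2 scaleN1r.
    case: g => //.
    * by rewrite [LHS]H2 [RHS]pol_module_H2.
    * by rewrite [LHS]Xp2 [RHS]pol_module_Xp2.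
    * by rewrite [LHS]Xm2 [RHS]pol_module_Xm2.
- by rewrite M1 PM1.
- by rewrite !(linear_fZ (uact_linearr _ _)) IH.
- by rewrite !(linear_fD (uact_linearr _ _)) IH IH'.
rewrite MM PMM; congr mult; case: g.
- by rewrite [LHS]tensor_act_H [RHS]tensor_act_H IH IH'.
- by rewrite [LHS]tensor_act_Xp [RHS]tensor_act_Xp !(IH, IH').
- by rewrite [LHS]tensor_act_Xm [RHS]tensor_act_Xm !(IH, IH').
- by rewrite [LHS]tensor_act_K [RHS]tensor_act_K IH IH'.
- by rewrite [LHS]tensor_act_Ki [RHS]tensor_act_Ki IH IH'.
Qed.

End PolModule.

Section Pol2.
Variables (R : realType) (q : R) (Y1 Y2 : quadric).

Definition Pol2 : Type := tensor (Pol q Y1)^c (Pol q Y2).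
HB.instance Definition _ := GRing.PzRing.on Pol2.
HB.instance Definition _ := GRing.Lmodule.on Pol2.

Definition pol2_t (i j : idx) : Pol2 := tpure (pol_t i j : (Pol q Y1)^c) 1.
Definition pol2_tau (i j : idx) : Pol2 := tpure (1 : (Pol q Y1)^c) (pol_t i j).

Local Notation t := pol2_t.
Local Notation tau := pol2_tau.

Definition k11 : Pol2 := t i1 i1 * tau i2 i2 - q%:C *: (t i1 i2 * tau i2 i1).
Definition k12 : Pol2 :=
  - q%:C^-1 *: (t i1 i1 * tau i1 i2) + t i1 i2 * tau i1 i1.
Definition k21 : Pol2 := t i2 i1 * tau i2 i2 - q%:C *: (t i2 i2 * tau i2 i1).
Definition k22 : Pol2 :=
  - q%:C^-1 *: (t i2 i1 * tau i1 i2) + t i2 i2 * tau i1 i1.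

(* The module structure of Pol(Y1)^op is that of Pol(Y1). *)
Definition pol2_module (h : R) (h0 : 0 < h) (qh : q = expR (- (h / 2))) :
    uqmodule h Pol2 :=
  tensor_module (pol_module Y1 h0 qh) (pol_module Y2 h0 qh).

End Pol2.

(* Main.v *)
Require Import Defs.
From HB Require Import structures.
From mathcomp Require Import all_boot all_order all_algebra.
From mathcomp Require Import complex ring.
From mathcomp Require Import boolp reals sequences exp.

(** If [(a1, a2)] and [(b1, b2)] both span copies of the two-dimensional
    representation, then [a1 ⊗ b2 - q a2 ⊗ b1] is invariant in the tensor
    product, and invariance can be checked on the generators of the quantum
    group. Each [k_ij] is a scalar multiple of such an element, for the [i]-th
    row of the first factor and a row of the second one. *)

Import Order.TTheory GRing.Theory Num.Theory.

Local Open Scope ring_scope.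

Local Notation "x %:C" := (real_complex _ x) : ring_scope.

Section Invariants.
Variables (R : realType) (h : R) (V : lmodType R[i]) (M : uqmodule h V).

(** No condition on [uK] and [uKi] is needed: [v] has weight 0, so both act on it by e^0 = 1, their
    counit. The identity then passes to sums and products because the counit is an algebra
    morphism. *)
Lemma uq_invariant_gen (v : V) :
  M (uH h) v = 0 -> M (uXp h) v = 0 -> M (uXm h) v = 0 -> uq_invariant M v.
Proof.
move=> Hv Xpv Xmv.
have Hv0 : M (uH h) v = 0%:~R *: v by rewrite Hv scale0r.
have w0 : weight_exp h 0 = 1 by rewrite /weight_exp mulr0 mul0r expR0.
move=> x; elim/palg_ind: x => [[]||c x IH|x y IH IH'|x y IH IH'].
- by rewrite [LHS]Hv counit_H scale0r.
- by rewrite [LHS]Xpv counit_Xp scale0r.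
- by rewrite [LHS]Xmv counit_Xm scale0r.
- by rewrite [LHS](uact_K Hv0) counit_K -/(weight_exp h 0) w0.
- by rewrite [LHS](uact_Ki Hv0) oppr0 w0 counit_Ki.
- by rewrite uact1 counit1 scale1r.
- by rewrite (linear_fZ (uact_linearl M _)) counitZ IH scalerA.
- by rewrite (linear_fD (uact_linearl M _)) counitD IH IH' scalerDl.
- rewrite uactM IH' (linear_fZ (uact_linearr M _)) IH counitM scalerA.
  by rewrite mulrC.
Qed.

Lemma uq_invariantZ c (v : V) : uq_invariant M v -> uq_invariant M (c *: v).
Proof.
by move=> Mv x; rewrite (linear_fZ (uact_linearr M _)) Mv !scalerA mulrC.
Qed.

(** The second element is -1/c times the first. With c = q this gives the normalisation of [k12] and
    [k22]. *)
Lemma uq_invariant_factor c (u v : V) : c != 0 ->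
  uq_invariant M (u - c *: v) -> uq_invariant M (- c^-1 *: u + v).
Proof.
move=> c0 /(uq_invariantZ (- c^-1)).
by rewrite scalerBr scalerA mulNr mulVf// scaleN1r opprK.
Qed.

(** The formulas by which each row (t_i1, t_i2) transforms. The actions of [uK] and [uKi] are left
    out, since the weights 1 and -1 determine them. *)
Definition uq_doublet (v1 v2 : V) : Prop :=
  [/\ M (uH h) v1 = v1, M (uXp h) v1 = 0 & M (uXm h) v1 = v2] /\
  [/\ M (uH h) v2 = - v2, M (uXp h) v2 = v1 & M (uXm h) v2 = 0].

Lemma uq_doublet_K (v1 v2 : V) : uq_doublet v1 v2 ->
  [/\ M (uK h) v1 = (expR (h / 4))%:C *: v1,
      M (uKi h) v1 = (expR (- (h / 4)))%:C *: v1,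
      M (uK h) v2 = (expR (- (h / 4)))%:C *: v2 &
      M (uKi h) v2 = (expR (h / 4))%:C *: v2].
Proof.
move=> [[H1 _ _] [H2 _ _]].
have {}H1 : M (uH h) v1 = 1%:~R *: v1 by rewrite H1 scale1r.
have {}H2 : M (uH h) v2 = (-1)%:~R *: v2 by rewrite H2 scaleN1r.
rewrite (uact_K H1) (uact_Ki H1) (uact_K H2) (uact_Ki H2) /weight_exp opprK.
by rewrite mulr1 mulrN1 mulNr.
Qed.

End Invariants.

Arguments uq_doublet {R h V}.
Arguments uq_doublet_K {R h V M v1 v2}.

(** The total weight is 0. Under X+ both pure tensors become multiples of v1 ⊗ w1, under X- of v2 ⊗
    w2; in each case the coefficients are e^{-h/4} and e^{h/4}, so the factor q = e^{-h/2} makes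
    them cancel. *)
Lemma tensor_doublet_invariant (R : realType) (h : R) (V W : lmodType R[i])
    (M : uqmodule h V) (N : uqmodule h W) (v1 v2 : V) (w1 w2 : W) :
  uq_doublet M v1 v2 -> uq_doublet N w1 w2 ->
  uq_invariant (tensor_module M N)
    (v1 ⊗ w2 - (expR (- (h / 2)))%:C *: (v2 ⊗ w1)).
Proof.
move=> Mv Nw; have [Kv1 Kiv1 Kv2 Kiv2] := uq_doublet_K Mv.
have [Kw1 Kiw1 Kw2 Kiw2] := uq_doublet_K Nw.
have [[Hv1 Xpv1 Xmv1] [Hv2 Xpv2 Xmv2]] := Mv.
have [[Hw1 Xpw1 Xmw1] [Hw2 Xpw2 Xmw2]] := Nw.
have qs : (expR (- (h / 2)))%:C * (expR (h / 4))%:C =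
          (expR (- (h / 4)))%:C :> R[i].
  rewrite -rmorphM -expRD; congr (expR _)%:C.
  have -> : h / 2 = h / 4 + h / 4 by field.
  by rewrite opprD addrNK.
have tN (u : V) (w : W) : u ⊗ (- w) = - (u ⊗ w) :=
  linear_fN (tpure_linearr u) w.
have Nt (u : V) (w : W) : (- u) ⊗ w = - (u ⊗ w) :=
  linear_fN (tpure_linearl w) u.
have t0 (u : V) : u ⊗ (0 : W) = 0 := linear_f0 (tpure_linearr u).
have z0 (w : W) : (0 : V) ⊗ w = 0 := linear_f0 (tpure_linearl w).
have TB x c a b : tensor_module M N x (a - c *: b) =
    tensor_module M N x a - c *: tensor_module M N x b.
  by rewrite -!scaleNr (linear_fD (uact_linearr _ _))
    (linear_fZ (uact_linearr _ _)).
apply: uq_invariant_gen; rewrite TB /=.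
- rewrite !tensor_act_H Hv1 Hw2 Hv2 Hw1 tN Nt addrN addNr.
  by rewrite scaler0 subrr.
- rewrite !tensor_act_Xp Xpv1 Xpw2 Xpv2 Xpw1 Kw1 Kiv1 z0 t0 add0r addr0.
  by rewrite tpureZl tpureZr scalerA qs subrr.
- rewrite !tensor_act_Xm Xmv1 Xmw2 Xmv2 Xmw1 Kw2 Kiv2 z0 t0 add0r addr0.
  by rewrite tpureZl tpureZr scalerA qs subrr.
Qed.

Lemma pol_module_doublet (R : realType) (q h : R) (Y : quadric) (h0 : 0 < h)
    (qh : q = expR (- (h / 2))) (i : idx) :
  uq_doublet (pol_module Y h0 qh) (pol_t i i1) (pol_t i i2).
Proof.
split; split.
- exact: pol_module_H1.
- exact: pol_module_Xp1.
- exact: pol_module_Xm1.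
- exact: pol_module_H2.
- exact: pol_module_Xp2.
- exact: pol_module_Xm2.
Qed.

(** Each tensor leg is multiplied only by 1, so the opposite product on the first factor has no
    effect. *)
Lemma pol2_t_tau (R : realType) (q : R) (Y1 Y2 : quadric) (i j k l : idx) :
  pol2_t q Y1 Y2 i j * pol2_tau q Y1 Y2 k l =
  (pol_t i j : (Pol q Y1)^c) ⊗ (pol_t k l : Pol q Y2) :> Pol2 q Y1 Y2.
Proof. by rewrite [LHS]tensor_mulE mulr1 mul1r. Qed.

Lemma pol2_invariant (R : realType) (q h : R) (h0 : 0 < h)
    (qh : q = expR (- (h / 2))) (Y1 Y2 : quadric) (i j : idx) :
  uq_invariant (pol2_module Y1 Y2 h0 qh)
    (pol2_t q Y1 Y2 i i1 * pol2_tau q Y1 Y2 j i2 -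
     q%:C *: (pol2_t q Y1 Y2 i i2 * pol2_tau q Y1 Y2 j i1)).
Proof.
have := tensor_doublet_invariant _ _ _ _ _ _ _ _ _ _
  (pol_module_doublet _ _ _ Y1 h0 qh i) (pol_module_doublet _ _ _ Y2 h0 qh j).
by rewrite !pol2_t_tau -qh.
Qed.

Theorem proposition6p1 (R : realType) (q h : R) (q01 : 0 < q < 1)
    (h0 : 0 < h) (qh : q = expR (- (h / 2))) (Y1 Y2 : quadric) :
  [/\ uq_invariant (pol2_module Y1 Y2 h0 qh) (k11 q Y1 Y2),
      uq_invariant (pol2_module Y1 Y2 h0 qh) (k12 q Y1 Y2),
      uq_invariant (pol2_module Y1 Y2 h0 qh) (k21 q Y1 Y2) &
      uq_invariant (pol2_module Y1 Y2 h0 qh) (k22 q Y1 Y2)].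
Proof.
have q0 : q%:C != 0 :> R[i] by case/andP: q01 => q_gt0 _; rewrite fmorph_eq0 gt_eqF.
split.
(* Here i is the first index of [k_ij], while the row of the second factor is 2 for [k11], [k21] and
   1 for [k12], [k22]. *)
- exact: pol2_invariant.
- by apply: uq_invariant_factor => //; exact: pol2_invariant.
- exact: pol2_invariant.
- by apply: uq_invariant_factor => //; exact: pol2_invariant.
Qed.
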